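(* Let $(\mathcal{A},\varphi)$ be a $*$-probability space, and let $M=[a_{i,j}]_{i,j=1}^d\in M_d(\mathcal{A})$ be a traceless CCR-GUE matrix with parameters $w_1,\ldots,w_d$. Consider the linear functional $\varphi_{\underline{w}}:M_d(\mathcal{A})\to\mathbb{C}$ defined by $$\varphi_{\underline{w}}(X)=\sum_{i=1}^d w_i\,\varphi(x_{i,i}),\qquad X=[x_{i,j}]_{i,j=1}^d\in M_d(\mathcal{A}).$$ Then the law of $M$ in the $*$-probability space $(M_d(\mathcal{A}),\varphi_{\underline{w}})$ is equal to $\mu_{\underline{w}}$; that is, $\varphi_{\underline{w}}(M^k)=\int_{\mathbb{R}}t^k\,d\mu_{\underline{w}}(t)$ for every $k\in\mathbb{N}$.
   Context: Fix an integer $d\ge 2$ and weights $\underline{w}=(w_1,\ldots,w_d)$ with $w_1\ge\cdots\ge w_d>0$ and $w_1+\cdots+w_d=1$. For $n\in\mathbb{N}=\{1,2,\ldots\}$ put $\mathsf{p}_n:=w_1^n+\cdots+w_d^n$. **The measure $\mu_{\underline{w}}$.** $S_\infty$ is the group of finitely supported permutations of $\mathbb{N}$ (products are compositions, read right to left), with unit $e$; $\gamma_n:=(1,n+1)$. Define the character $\chi:S_\infty\to\mathbb{R}$ by $\chi(\sigma):=\prod_V\mathsf{p}_{|V|}$, the product over orbits $V$ of $\sigma$ with $|V|\ge2$ (empty product $=1$). Its GNS representation consists of a complex Hilbert space $\mathcal{H}$ with a map $\sigma\mapsto\widehat{\sigma}\in\mathcal{H}$ whose image has dense linear span and $\langle\widehat{\sigma},\widehat{\tau}\rangle=\chi(\sigma\tau^{-1})$,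 and of the unitary representation $U$ of $S_\infty$ on $\mathcal{H}$ with $U(\sigma)\widehat{\tau}=\widehat{\sigma\tau}$. $\mathcal{M}\subseteq B(\mathcal{H})$ is the von Neumann algebra obtained as WOT-closure of $\mathrm{span}\{U(\sigma):\sigma\in S_\infty\}$, with faithful trace-state $\mathrm{tr}(T)=\langle T\widehat{e},\widehat{e}\rangle$. $A_0\in\mathcal{M}$ is the SOT-limit of $\frac1n\sum_{i=1}^nU(\gamma_i)$ (known to exist; selfadjoint). Let $\mu_n$ be the law of $\frac1{\sqrt n}\sum_{i=1}^n(U(\gamma_i)-A_0)$ in $(\mathcal{M},\mathrm{tr})$, i.e. the compactly supported probability measure on $\mathbb{R}$ whose $k$-th moment is $\mathrm{tr}$ of the $k$-th power of this element. Then $\mu_{\underline{w}}$ is the weak limit of $\mu_n$ as $n\to\infty$, a probability measure on $\mathbb{R}$; it is known to exist, to have finite moments of all orders (the limits of the moments of $\mu_n$), and to be uniquely determined by its moments. **$*$-probability space.** A pair $(\mathcal{A},\varphi)$ with $\mathcal{A}$ a unital $*$-algebra over $\mathbb{C}$ and $\varphi:\mathcal{A}\to\mathbb{C}$ linear with $\varphi(1_{\mathcal{A}})=1$ and $\varphi(a^*a)\ge0$ for all $a$. **Commuting independence.** Unital $*$-subalgebras $(\mathcal{A}_\lambda)_{\lambda\in\Lambda}$ of $\mathcal{A}$ are commuting independent if (i) $x_1x_2=x_2x_1$ whenever $x_1\in\mathcal{A}_{\lambda_1},x_2\in\mathcal{A}_{\lambda_2}$ with $\lambda_1\ne\lambda_2$;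 and (ii) $\varphi(x_1\cdots x_k)=\varphi(x_1)\cdots\varphi(x_k)$ whenever $\lambda_1,\ldots,\lambda_k$ are distinct and $x_1\in\mathcal{A}_{\lambda_1},\ldots,x_k\in\mathcal{A}_{\lambda_k}$. **Centred CCR-complex-Gaussian element.** For $\omega_{(1,* )},\omega_{( *,1)}\in(0,\infty)$, an element $a\in\mathcal{A}$ is centred CCR-complex-Gaussian with parameters $\omega_{(1,* )}$ and $\omega_{( *,1)}$ if $a^*a=aa^*+(\omega_{( *,1)}-\omega_{(1,* )})1_{\mathcal{A}}$ and, for $p,q\in\mathbb{N}\cup\{0\}$, $\varphi(a^p(a^* )^q)=0$ if $p\ne q$, and $\varphi(a^p(a^* )^p)=p!\,\omega_{(1,* )}^p$. **Centred Gaussian family.** Selfadjoint elements $x_1,\ldots,x_d$ of a commutative unital $*$-subalgebra form a centred Gaussian family with covariance matrix $C=[c_{i,j}]$ (real symmetric) if for all $k\ge1$ and $\underline{i}:\{1,\ldots,k\}\to\{1,\ldots,d\}$, $\varphi(x_{\underline{i}(1)}\cdots x_{\underline{i}(k)})=\sum_{\rho}\prod_{\{p,q\}\in\rho}c_{\underline{i}(p),\underline{i}(q)}$, the sum over all pair-partitions $\rho$ of $\{1,\ldots,k\}$ (equal to $0$ for $k$ odd). **Traceless CCR-GUE matrix with parameters $w_1,\ldots,w_d$.** Suppose $\{\mathcal{A}_o\}\cup\{\mathcal{A}_{i,j}:1\le i<j\le d\}$ is a commuting independent family of unital $*$-subalgebras of $\mathcal{A}$, such that: (i) for every $1\le i<j\le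 d$ there is given a centred CCR-complex-Gaussian element $a_{i,j}\in\mathcal{A}_{i,j}$ with parameters $\omega_{(1,* )}=w_j$ and $\omega_{( *,1)}=w_i$, and one puts $a_{j,i}:=a_{i,j}^*$; (ii) $\mathcal{A}_o$ is commutative and there are given selfadjoint $a_{1,1},\ldots,a_{d,d}\in\mathcal{A}_o$ forming a centred Gaussian family with covariance matrix $c_{i,i}=w_i-w_i^2$ and $c_{i,j}=c_{j,i}=-w_iw_j$ for $i<j$. Then the selfadjoint matrix $M=[a_{i,j}]_{1\le i,j\le d}\in M_d(\mathcal{A})$ is called a traceless CCR-GUE matrix with parameters $w_1,\ldots,w_d$. *)

(* Defs.v *)
From HB Require Import structures.
From mathcomp Require Import all_boot all_order all_algebra sesquilinear finmap.
From mathcomp Require Import all_classical all_reals all_analysis complex.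

Set Implicit Arguments.
Unset Strict Implicit.
Unset Printing Implicit Defensive.

Import Order.TTheory GRing.Theory Num.Theory.
Import numFieldNormedType.Exports.

Local Open Scope classical_set_scope.
Local Open Scope ring_scope.
Local Open Scope complex_scope.

(* The infinite symmetric group.  The labels 1, 2, 3, ... of the mathematical
   text are shifted to 0, 1, 2, ..., so that the transposition (1, n+1) becomes
   (0, n). *)

Record Sinf := MkSinf {
  sinf_fun :> nat -> nat;
  sinf_inv : nat -> nat;
  sinf_funK : cancel sinf_fun sinf_inv;
  sinf_invK : cancel sinf_inv sinf_fun;
  sinf_fin : finite_set [set n | sinf_fun n != n] }.

Lemma sinf_ext (s t : Sinf) : s =1 t -> s = t.
Proof.
case: s => f g fK gK fF; case: t => f' g' fK' gK' fF' /= /funext ff'.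
subst f'.
have gg' : g = g' by apply/funext => n; rewrite -{1}[n]gK' fK.
subst g'; congr MkSinf; exact: Prop_irrelevance.
Qed.

Lemma sinf_one_fin : finite_set [set n : nat | id n != n].
Proof. by apply: (sub_finite_set _ (finite_set0 nat)) => n /=; rewrite eqxx. Qed.

Definition sinf_one : Sinf :=
  @MkSinf id id (fun=> erefl) (fun=> erefl) sinf_one_fin.

Lemma sinf_mul_fin (s t : Sinf) : finite_set [set n | (s \o t) n != n].
Proof.
apply: (@sub_finite_set _ _ ([set n | t n != n] `|` [set n | s n != n])).
  move=> n /=; case: (eqVneq (t n) n) => [-> ?|? _]; by [right|left].
by rewrite finite_setU; split; exact: sinf_fin.
Qed.

Definition sinf_mul (s t : Sinf) : Sinf :=
  MkSinf (can_comp (@sinf_funK s) (@sinf_funK t))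
         (can_comp (@sinf_invK t) (@sinf_invK s)) (sinf_mul_fin s t).

Lemma sinf_opp_fin (s : Sinf) : finite_set [set n | sinf_inv s n != n].
Proof.
apply: (sub_finite_set _ (sinf_fin s)) => n /=; apply: contraNneq => sn.
by rewrite -{1}sn sinf_funK.
Qed.

Definition sinf_opp (s : Sinf) : Sinf :=
  MkSinf (@sinf_invK s) (@sinf_funK s) (sinf_opp_fin s).

HB.instance Definition _ := gen_eqMixin Sinf.
HB.instance Definition _ := gen_choiceMixin Sinf.

Lemma sinf_mulA : associative sinf_mul.
Proof. by move=> s t u; apply: sinf_ext. Qed.
Lemma sinf_mul1 : left_id sinf_one sinf_mul.
Proof. by move=> s; apply: sinf_ext. Qed.
Lemma sinf_mulr1 : right_id sinf_one sinf_mul.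
Proof. by move=> s; apply: sinf_ext. Qed.
Lemma sinf_mulV : left_inverse sinf_one sinf_opp sinf_mul.
Proof. by move=> s; apply: sinf_ext => n /=; rewrite sinf_funK. Qed.
Lemma sinf_mulrV : right_inverse sinf_one sinf_opp sinf_mul.
Proof. by move=> s; apply: sinf_ext => n /=; rewrite sinf_invK. Qed.

HB.instance Definition _ := isGroup.Build Sinf
  sinf_mulA sinf_mul1 sinf_mulr1 sinf_mulV sinf_mulrV.

Definition swap0 (n : nat) : nat -> nat := [eta id with 0%N |-> n, n |-> 0%N].

Lemma swap0K n : cancel (swap0 n) (swap0 n).
Proof.
move=> m; rewrite /swap0 /=; case: (eqVneq m 0%N) => [->|m0].
  by case: (eqVneq n 0%N) => [->|_]; rewrite ?eqxx.
case: (eqVneq m n) => [->|mn]; first by rewrite eqxx.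
by rewrite (negPf m0) (negPf mn).
Qed.

Lemma swap0_fin n : finite_set [set m | swap0 n m != m].
Proof.
apply: (@sub_finite_set _ _ [set 0%N; n]); last exact: finite_set2.
move=> m; rewrite /swap0 /=; case: (eqVneq m 0%N) => [->|_]; first by left.
by case: (eqVneq m n) => [->|_]; [right | rewrite eqxx].
Qed.

Definition gamma (n : nat) : Sinf :=
  MkSinf (@swap0K n) (@swap0K n) (swap0_fin n).

Definition sinf_orbit (s : Sinf) (n : nat) : set nat :=
  [set m | exists k, m = iter k s n \/ n = iter k s m].

Definition moved_orbits (s : Sinf) : set (set nat) :=
  [set V | (exists n, V = sinf_orbit s n) /\ (2 <= #|` fset_set V|)%N].

Definition is_weights (R : realType) (d : nat) (w : 'I_d -> R) : Prop :=
  [/\ forall i j : 'I_d, (i <= j)%N -> w j <= w i,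
      forall i, 0 < w i
    & \sum_i w i = 1].

Definition psum (R : realType) (d : nat) (w : 'I_d -> R) (n : nat) : R :=
  \sum_i w i ^+ n.

Definition chi (R : realType) (d : nat) (w : 'I_d -> R) (s : Sinf) : R :=
  \big[*%R/1]_(V \in moved_orbits s) psum w #|` fset_set V|.

Section GNS.
Context {R : realType} {H : completeNormedModType R[i]}.
(* linear in the first variable, antilinear in the second *)
Variable ip : {dot H for (@Num.conj R[i])}.
Variables (hat : Sinf -> H) (U : Sinf -> {linear H -> H}).

(* The first clause makes [H] a Hilbert space for [ip].  Each [U s] is
   isometric with inverse [U s^-1], hence unitary. *)
Definition is_gns (d : nat) (w : 'I_d -> R) : Prop :=
  [/\ forall x : H, ip x x = `|x| ^+ 2,
      dense [set x : H | exists c : seq (R[i] * Sinf),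
                           x = \sum_(p <- c) p.1 *: hat p.2],
      forall s t : Sinf, ip (hat s) (hat t) = (chi w (s * t^-1)%g)%:C,
      [/\ forall x, U 1%g x = x,
          forall (s t : Sinf) x, U (s * t)%g x = U s (U t x)
        & forall s x y, ip (U s x) (U s y) = ip x y]
    & forall s t : Sinf, U s (hat t) = hat (s * t)%g].

(* The von Neumann algebra generated by U: bounded operators in the closure of
   span {U s} for the weak operator topology. *)
Definition vNalg : set {linear H -> H} :=
  [set T | continuous T /\
    forall (e : R) (xys : seq (H * H)), 0 < e ->
      exists c : seq (R[i] * Sinf), forall xy, xy \in xys ->
        `|ip (T xy.1 - \sum_(p <- c) p.1 *: U p.2 xy.1) xy.2| < e%:C].

Definition is_sot_mean (A0 : {linear H -> H}) : Prop :=
  vNalg A0 /\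
  forall x : H,
    (fun n : nat => (n%:R : R[i])^-1 *: \sum_(1 <= i < n.+1) U (gamma i) x)
      @ \oo --> A0 x.

Definition fluctuation (A0 : {linear H -> H}) (n : nat) (x : H) : H :=
  ((Num.sqrt (n%:R : R))^-1)%:C *:
    \sum_(1 <= i < n.+1) (U (gamma i) x - A0 x).

Definition tr (T : H -> H) : R[i] := ip (T (hat 1%g)) (hat 1%g).

Definition has_law (T : H -> H) (mu : probability (measurableTypeR R) R) :
    Prop :=
  (exists K : R, mu `[- K, K]%classic = 1%E) /\
  forall k : nat, (\int[mu]_t (t ^+ k))%:C = tr (iter k T).

End GNS.

Definition cvg_weakly (R : realType)
    (mun : nat -> probability (measurableTypeR R) R)
    (mu : probability (measurableTypeR R) R) : Prop :=
  forall f : R -> R, continuous f -> bounded_fun f ->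
    (fun n => \int[mun n]_t f t) @ \oo --> \int[mu]_t f t.

(* The GNS representation is unique up to unitary equivalence, so the choice of
   a realization does not matter. *)
Definition is_mu (R : realType) (d : nat) (w : 'I_d -> R)
    (mu : probability (measurableTypeR R) R) : Prop :=
  exists (H : completeNormedModType R[i]) (ip : {dot H for (@Num.conj R[i])})
         (hat : Sinf -> H) (U : Sinf -> {linear H -> H})
         (A0 : {linear H -> H})
         (mun : nat -> probability (measurableTypeR R) R),
    [/\ is_gns ip hat U w,
        is_sot_mean ip U A0,
        forall n, (0 < n)%N -> has_law ip hat (fluctuation U A0 n) (mun n)
      & cvg_weakly mun mu].

Section StarProbabilitySpace.
Context {R : realType} {A : algType R[i]}.
Variables (star : A -> A) (phi : {scalar A}).

Definition is_star : Prop :=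
  [/\ {morph star : a b / a + b},
      forall (c : R[i]) (a : A), star (c *: a) = Num.conj c *: star a,
      forall a b : A, star (a * b) = star b * star a
    & involutive star].

Definition is_star_prob_space : Prop :=
  [/\ is_star, phi 1 = 1 & forall a : A, 0 <= phi (star a * a)].

Definition is_star_subalg (B : set A) : Prop :=
  [/\ B 1,
      forall (c : R[i]) (a b : A), B a -> B b -> B (c *: a + b),
      forall a b : A, B a -> B b -> B (a * b)
    & forall a : A, B a -> B (star a)].

Definition commuting_independent (I : Type) (B : I -> set A) : Prop :=
  (forall (l1 l2 : I) (x1 x2 : A), l1 <> l2 -> B l1 x1 -> B l2 x2 ->
     x1 * x2 = x2 * x1) /\
  (forall (k : nat) (l : 'I_k -> I) (x : 'I_k -> A), injective l ->
     (forall j, B (l j) (x j)) ->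
     phi (\prod_(j < k) x j) = \prod_(j < k) phi (x j)).

Definition ccr_complex_gaussian (om1 oms : R) (a : A) : Prop :=
  [/\ 0 < om1, 0 < oms,
      star a * a = a * star a + ((oms - om1)%:C)%:A
    & forall p q : nat,
        phi (a ^+ p * star a ^+ q) =
          if p == q then (p`!%:R * om1 ^+ p)%:C else 0].

Definition pair_partition (k : nat) (rho : {set {set 'I_k}}) : bool :=
  finset.partition rho [set: 'I_k]%SET && [forall B in rho, #|B| == 2%N].

Definition gaussian_family (d : nat) (x : 'I_d -> A) (c : 'M[R]_d) : Prop :=
  (forall i, star (x i) = x i) /\
  forall (k : nat) (i : 'I_k -> 'I_d), (0 < k)%N ->
    phi (\prod_(j < k) x (i j)) =
      (\sum_(rho : {set {set 'I_k}} | pair_partition rho)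
         \prod_(p : 'I_k) \prod_(q : 'I_k | (p < q)%N && ([set p; q]%SET \in rho))
           c (i p) (i q))%:C.

Definition upper_index (d : nat) := {p : 'I_d * 'I_d | (p.1 < p.2)%N}.

Definition traceless_cov (d : nat) (w : 'I_d -> R) : 'M[R]_d :=
  \matrix_(i, j) (if i == j then w i - w i ^+ 2 else - (w i * w j)).

(* [B None] is the algebra of the diagonal entries, [B (Some (i, j))] the
   algebra of the (i, j) entry, i < j. *)
Definition traceless_ccr_gue (d : nat) (w : 'I_d -> R) (M : 'M[A]_d) : Prop :=
  exists B : option (upper_index d) -> set A,
    [/\ forall l, is_star_subalg (B l),
        commuting_independent B,
        forall p : upper_index d, let: (i, j) := val p in
          [/\ B (Some p) (M i j),
              ccr_complex_gaussian (w j) (w i) (M i j)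
            & M j i = star (M i j)],
        forall a b : A, B None a -> B None b -> a * b = b * a
      & (forall i, B None (M i i)) /\
        gaussian_family (fun i => M i i) (traceless_cov w)].

Definition phi_w (d : nat) (w : 'I_d -> R) (X : 'M[A]_d) : R[i] :=
  \sum_i (w i)%:C * phi (X i i).

End StarProbabilitySpace.

(* Main.v *)
(* In the infinite tensor power of the d x d matrices, with the product state
   given by the density matrix diag w, the character chi is the trace of the
   permutations of the tensor factors.  There the transposition (0, v) is
   sum_{a,b} E_ab (x) E_ba, with E_ab at the point 0 and E_ba at the point v,
   and the strong limit A_0 of the means acts as diag w at the point 0: in
   inner products, the m-th term of the mean no longer depends on m once the
   point m is not moved by the other factors.  Hence the sum of the first n
   fluctuations is a d x d matrix whose (a, b) entry is the sum, over n
   commuting independent points, of copies of the centred matrix unit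
   E_ba - delta_ab w_a.  By the noncommutative central limit theorem for such
   sums, the rescaled mixed moments of the entries converge to sums over
   pairings of products of covariances.  Such sums obey the commutation
   relations of the entries of M and factor over the independent algebras, and
   they agree with phi on words sorted by algebra, hence on all words. *)

Require Import Defs.
From HB Require Import structures.
From mathcomp Require Import all_boot all_order all_algebra sesquilinear finmap.
From mathcomp Require Import all_classical all_reals all_analysis complex.
From mathcomp Require Import perm measurable_realfun ring lra zify.

Set Implicit Arguments.
Unset Strict Implicit.
Unset Printing Implicit Defensive.

Import Order.TTheory GRing.Theory Num.Theory.
Import numFieldNormedType.Exports.

Local Open Scope classical_set_scope.
Local Open Scope ring_scope.
Local Open Scope complex_scope.

(** * Pairings and splittings of words *)

Section Select.
Context {R : comNzRingType} {I : eqType}.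
Implicit Types (s t u v : seq I) (x y z : I).

(** The sum runs over positions, so equal letters count separately; [b] is the rest of the word in
    its original order. *)
Fixpoint select (F : I -> seq I -> R) s : R :=
  if s is y :: t then F y t + select (fun z b => F z (y :: b)) t else 0.

Lemma eq_select F G s :
  (forall y b, perm_eq (y :: b) s -> F y b = G y b) -> select F s = select G s.
Proof.
elim: s F G => [//|y t IH] F G FG /=.
rewrite (FG y t) //; congr (_ + _); apply: IH => z b /permPl zb; apply: FG.
by rewrite -cat1s -[z :: _]cat1s (perm_catCA [:: z] [:: y] b) /= perm_cons zb.
Qed.

Lemma selectD F G s :
  select (fun y b => F y b + G y b) s = select F s + select G s.
Proof.
by elim: s F G => [|y t IH] F G /=; rewrite ?addr0 // IH addrACA.
Qed.

Lemma selectZ c F s : select (fun y b => c * F y b) s = c * select F s.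
Proof. by elim: s F => [|y t IH] F /=; rewrite ?mulr0 // IH mulrDr. Qed.

Lemma select0 s : select (fun _ _ => 0) s = 0.
Proof. by elim: s => //= y t ->; rewrite addr0. Qed.

Lemma select_cat F s t :
  select F (s ++ t) =
  select (fun y b => F y (b ++ t)) s + select (fun y b => F y (s ++ b)) t.
Proof.
by elim: s F => [|y s IH] F /=; rewrite ?add0r // IH addrA.
Qed.

(** Both sides run over the ordered pairs of distinct positions, and the remaining word does not
    depend on which of the two is removed first. *)
Lemma select_swap (F : I -> I -> seq I -> R) s :
  select (fun y => select (fun z c => F y z c)) s =
  select (fun y => select (fun z c => F z y c)) s.
Proof.
elim: s F => [//|x t IH] F /=.
rewrite !selectD (IH (fun y z c => F y z (x :: c))).
by rewrite !addrA [_ + select (F x) t]addrC.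
Qed.

Variable C : I -> I -> R.

(** The remainder [b] is not a subterm of the word, hence the fuel [n]. Each unit of fuel pays for
    two letters, so the length of the word is always enough. *)
Fixpoint wick_rec n s : R :=
  match n, s with
  | _, [::] => 1
  | n'.+1, x :: t => select (fun y b => C x y * wick_rec n' b) t
  | 0%N, _ => 0
  end.

(* the sum over all pairings of the letters of [s] of the products of the
   [C x y], [x] occurring before [y] *)
Definition wick s : R := wick_rec (size s) s.

Lemma wick_recE n s : (size s <= n)%N -> wick_rec n s = wick s.
Proof.
rewrite /wick; elim: n {-2}n (leqnn n) s => [|m IH] [|n] nm [|x t] //= tn.
apply: eq_select => y b /perm_size /= yb; congr (_ * _).
by rewrite (IH n) ?(IH (size t)) //; lia.
Qed.

Lemma wick_nil : wick [::] = 1. Proof. by []. Qed.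

Lemma wick_cons x t : wick (x :: t) = select (fun y b => C x y * wick b) t.
Proof.
rewrite {1}/wick /=; apply: eq_select => y b /perm_size /= yb.
by rewrite wick_recE // -yb.
Qed.

(** Pairings in which the two adjacent letters have other partners contribute equally on both sides;
    those that pair them with each other leave a pairing of [u ++ v] and differ only in the order of
    the arguments of [C]. This mirrors a commutation relation with scalar commutator. *)
Lemma wick_swap u x y v :
  wick (u ++ x :: y :: v) =
  wick (u ++ y :: x :: v) + (C x y - C y x) * wick (u ++ v).
Proof.
have [n un] := ubnP (size u); elim: n u un v => [//|n IH] [|h u] /= un v.
  rewrite !wick_cons /=.
  under eq_select do rewrite wick_cons -selectZ.
  rewrite select_swap.
  under [in RHS]eq_select do rewrite wick_cons -selectZ.
  set P := (X in _ + X = _); set Q := (X in _ = _ + X + _).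
  have -> : P = Q by apply: eq_select => z b _; apply: eq_select => t c _; ring.
  by ring.
rewrite !wick_cons !select_cat /=.
under eq_select => z b /perm_size /= zb.
  rewrite (_ : wick _ = wick (b ++ y :: x :: v) + (C x y - C y x) * wick (b ++ v)); last first.
    by apply: IH; lia.
  rewrite mulrDr mulrCA; over.
rewrite selectD selectZ.
have -> : select (fun z b => C h z * wick (u ++ [:: x, y & b])) v =
  select (fun z b => C h z * wick (u ++ [:: y, x & b])) v +
  (C x y - C y x) * select (fun z b => C h z * wick (u ++ b)) v.
  rewrite -selectZ -selectD; apply: eq_select => z b _.
  by rewrite IH //; ring.
by ring.
Qed.

(** A pairing with a pair across the cut has weight zero, so the first letter of [s] must find its
    partner in [s], and induction applies to what is left. *)
Lemma wick_cat s t : {in s & t, forall x y, C x y = 0} ->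
  wick (s ++ t) = wick s * wick t.
Proof.
have [n sn] := ubnP (size s); elim: n s sn => [//|n IH] [|x s] /= sn Cst.
  by rewrite mul1r.
rewrite !wick_cons select_cat mulrC -selectZ.
rewrite [X in _ + X](_ : _ = 0) ?addr0; last first.
  rewrite -(select0 t); apply: eq_select => y b /perm_mem yb.
  by rewrite Cst ?mul0r ?mem_head // -yb mem_head.
apply: eq_select => y b yb; rewrite IH; first by ring.
  by move: (perm_size yb) sn => /=; lia.
move=> z z' zb z't; apply: Cst => //.
by rewrite inE -(perm_mem yb) inE zb !orbT.
Qed.

End Select.

Section Split.
Context {R : comNzRingType} {I : eqType}.
Implicit Types (F G : seq I -> seq I -> R) (s t : seq I).

(** This is the unshuffle coproduct: every letter goes to one of two subwords, and both keep the
    original order. *)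
Fixpoint split_sum F s : R :=
  if s is x :: t then
    split_sum (fun a b => F (x :: a) b) t + split_sum (fun a b => F a (x :: b)) t
  else F [::] [::].

Lemma eq_split_sum F G s :
  (forall a b, (size a + size b = size s)%N -> F a b = G a b) ->
  split_sum F s = split_sum G s.
Proof.
elim: s F G => [|x t IH] F G FG /=; first exact: FG.
by congr (_ + _); apply: IH => a b ab; apply: FG; rewrite /= ?addnS ?addSn ab.
Qed.

Lemma split_sumD F G s :
  split_sum (fun a b => F a b + G a b) s = split_sum F s + split_sum G s.
Proof. by elim: s F G => [//|x t IH] F G /=; rewrite !IH addrACA. Qed.

Lemma split_sumZ c F s : split_sum (fun a b => c * F a b) s = c * split_sum F s.
Proof. by elim: s F => [//|x t IH] F /=; rewrite !IH mulrDr. Qed.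

Lemma split_sum0 s : split_sum (fun _ _ => 0) s = 0.
Proof. by elim: s => [//|x t IH] /=; rewrite !IH addr0. Qed.

(** Each side distributes the letters over three subwords; only the roles of the first two are
    exchanged. *)
Lemma split_sum_swap (F : seq I -> seq I -> seq I -> R) s :
  split_sum (fun a => split_sum (fun c e => F a c e)) s =
  split_sum (fun a => split_sum (fun c e => F c a e)) s.
Proof.
elim: s F => [//|x t IH] F /=; rewrite !split_sumD IH !addrA; congr (_ + _).
  by rewrite addrC IH.
by rewrite (IH (fun a c e => F a c (x :: e))).
Qed.

Lemma split_sum_select (F : I -> seq I -> R) s :
  split_sum (fun a b => if a is [:: y] then F y b else 0) s = select F s.
Proof.
have nilE (G : seq I -> R) t : split_sum (fun a b => if a is [::] then G b else 0) t = G t.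
  elim: t G => [//|x t IH] G /=.
  by rewrite split_sum0 add0r (IH (fun b => G (x :: b))).
by elim: s F => [//|x t IH] F /=; rewrite nilE (IH (fun y b => F y (x :: b))).
Qed.

Variable kappa : seq I -> R.

(* If [kappa] gives the moments of a family indexed by [I], then [conv n] gives
   the moments of the sum of [n] commuting independent copies of it. *)
Fixpoint conv n s : R :=
  if n is n'.+1 then split_sum (fun a b => kappa a * conv n' b) s
  else if s is [::] then 1 else 0.

(** The [n.+1] copies play the same role, so the copy that receives the first letter may be taken to
    be the outermost one, at the price of a factor [n.+1]. *)
Lemma conv_cons n x s :
  conv n.+1 (x :: s) =
  n.+1%:R * split_sum (fun a b => kappa (x :: a) * conv n b) s.
Proof.
elim: n s => [|n IH] s.
  rewrite /= mul1r. rewrite [X in _ + X](_ : _ = 0) ?addr0 //.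
  by rewrite -[RHS](split_sum0 s); apply: eq_split_sum => a b _ /=; rewrite mulr0.
rewrite -[LHS]/(split_sum (fun a b => kappa (x :: a) * conv n.+1 b) s +
  split_sum (fun a b => kappa a * conv n.+1 (x :: b)) s).
have -> : split_sum (fun a b => kappa a * conv n.+1 (x :: b)) s =
    n.+1%:R * split_sum (fun a b => kappa (x :: a) * conv n.+1 b) s.
  rewrite -split_sumZ; under eq_split_sum do rewrite IH mulrCA -split_sumZ.
  rewrite !split_sumZ; congr (_ * _).
  rewrite (split_sum_swap (fun a c e => kappa a * (kappa (x :: c) * conv n e))).
  apply: eq_split_sum => a b _ /=; rewrite -split_sumZ.
  by apply: eq_split_sum => c e _; rewrite mulrCA.
by rewrite -[n.+2]addn1 natrD mulrDl mul1r addrC.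
Qed.

End Split.

(** * The central limit theorem *)

Section Clt.
Context {R : realType} {I : eqType}.
Implicit Types s : seq I.

Lemma split_sum_cvg (F : nat -> seq I -> seq I -> R)
    (G : seq I -> seq I -> R) s :
  (forall a b, (size a + size b = size s)%N ->
    (fun n => F n a b) @ \oo --> G a b) ->
  (fun n => split_sum (F n) s) @ \oo --> split_sum G s.
Proof.
elim: s F G => [|x s IH] F G FG /=; first exact: FG.
apply: cvgD.
  by apply: (IH (fun n a b => F n (x :: a) b)) => a b ab; apply: FG; rewrite /= ?addnS ?addSn ab.
by apply: (IH (fun n a b => F n a (x :: b))) => a b ab; apply: FG; rewrite /= ?addnS ?addSn ab.
Qed.

Lemma sqrt_ratio_cvg :
  (fun n : nat => Num.sqrt (n%:R : R) / Num.sqrt n.+1%:R) @ \oo --> (1 : R).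
Proof.
have -> : (fun n : nat => Num.sqrt (n%:R : R) / Num.sqrt n.+1%:R) =
    Num.sqrt \o (fun n : nat => 1 - n.+1%:R^-1).
  apply/funext => n /=; rewrite -sqrtrV ?ler0n // -sqrtrM ?ler0n //; congr Num.sqrt.
  by rewrite -natr1; field; rewrite natr1 pnatr_eq0.
rewrite -[X in _ --> X](sqrtr1 R); apply: continuous_cvg.
  exact: sqrt_continuous.
rewrite -[X in _ --> X]subr0; apply: cvgB; first exact: cvg_cst.
exact: cvg_harmonic.
Qed.

Lemma invsqrt_cvg : (fun n : nat => (Num.sqrt (n.+1%:R : R))^-1) @ \oo --> (0 : R).
Proof.
have -> : (fun n : nat => (Num.sqrt (n.+1%:R : R))^-1) =
    Num.sqrt \o (fun n : nat => n.+1%:R^-1).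
  by apply/funext => n /=; rewrite sqrtrV ?ler0n.
rewrite -[X in _ --> X](sqrtr0 R); apply: continuous_cvg; first exact: sqrt_continuous.
exact: cvg_harmonic.
Qed.

Variable kappa : seq I -> R.
Hypothesis kappa0 : kappa [::] = 1.
Hypothesis kappa1 : forall x, kappa [:: x] = 0.

(** In [conv_cons] let [a] be the letters that share a copy with [x]. An empty [a] is killed by
    centring; a single letter balances the factor [n.+1] exactly against two square roots; more
    letters leave a negative power of the square root. The limit is therefore the recursion of
    [wick]. *)
Lemma conv_cvg s :
  (fun n : nat => (Num.sqrt n%:R)^-1 ^+ size s * conv kappa n s) @ \oo -->
  wick (fun x y => kappa [:: x; y]) s.
Proof.
have [m sm] := ubnP (size s); elim: m s sm => [//|m IH] [|x s] /= sm.
  rewrite (_ : (fun _ => _) = fun=> 1); first exact: cvg_cst.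
  by apply/funext => n; rewrite expr0 mul1r; elim: n => //= n ->; rewrite kappa0 mulr1.
rewrite -cvg_shiftS wick_cons -split_sum_select.
pose q n : R := (Num.sqrt n.+1%:R)^-1.
have q2 n : n.+1%:R * q n ^+ 2 = 1.
  by rewrite exprVn sqr_sqrtr ?ler0n // divff // pnatr_eq0.
(* The factor [n.+1] is absorbed by [x] and the head of [a], which leaves one [q n] for each further
   letter of [a]. The ratio of square roots turns the scaling by [n.+1] on [b] into the scaling by
   [n] of the induction hypothesis. *)
pose F n a b := kappa (x :: a) * (if a is _ :: a' then q n ^+ size a' else 0) *
  ((Num.sqrt n%:R / Num.sqrt n.+1%:R) ^+ size b *
   ((Num.sqrt n%:R)^-1 ^+ size b * conv kappa n b)).
rewrite (_ : (fun n => _) = fun n => split_sum (F n) s); last first.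
  apply/funext => n; rewrite conv_cons mulrCA mulrA -split_sumZ.
  apply: eq_split_sum => a b ab; rewrite /F -/(q n) -ab.
  have -> : (Num.sqrt n%:R / Num.sqrt n.+1%:R) ^+ size b *
     ((Num.sqrt n%:R)^-1 ^+ size b * conv kappa n b) = q n ^+ size b * conv kappa n b.
    (* For [n = 0] the ratio of square roots is zero, but [conv] with no copies vanishes on nonempty
       words as well. *)
    case: n {q2} => [|n]; first by case: b {ab} => [|? ?]; rewrite /= ?(expr0, mulr0, mulr1).
    by rewrite mulrA -exprMn mulrAC divff ?mul1r // sqrtr_eq0 -ltNge ltr0n.
  case: a {ab} => [|y a] /=; first by rewrite kappa1 !(mulr0,mul0r).
  rewrite addSn -[(_ + _).+2]addn2 !exprD.
  by have := q2 n; set N := n.+1%:R => qN; rewrite -[RHS]mul1r -qN; ring.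
apply: split_sum_cvg => a b ab.
have cb : (fun n => (Num.sqrt n%:R / Num.sqrt n.+1%:R) ^+ size b *
    ((Num.sqrt n%:R)^-1 ^+ size b * conv kappa n b)) @ \oo --> wick (fun x y => kappa [:: x; y]) b.
  rewrite -[wick _ b]mul1r; apply: cvgM; last by apply: IH; lia.
  rewrite -[X in _ --> X](expr1n R (size b)).
  apply: (@continuous_cvg _ _ _ _ _ _ (fun x : R => x ^+ size b)); last exact: sqrt_ratio_cvg.
  exact: exprn_continuous.
case: a ab => [|y [|z a]] ab.
- by rewrite /F kappa1; under eq_fun do rewrite !mul0r; exact: cvg_cst.
- rewrite /F; under eq_fun do rewrite /= expr0 mulr1.
  by apply: cvgM cb; exact: cvg_cst.
- rewrite -[X in _ --> X](mul0r (wick (fun x y => kappa [:: x; y]) b)).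
  apply: cvgM cb; rewrite -[X in _ --> X](mulr0 (kappa [:: x, y, z & a])).
  apply: cvgM; first exact: cvg_cst.
  rewrite -[X in _ --> X](expr0n R (size (z :: a))).
  apply: (@continuous_cvg _ _ _ _ _ _ (fun x : R => x ^+ size (z :: a))); last exact: invsqrt_cvg.
  exact: exprn_continuous.
Qed.

End Clt.

(** * Sums over pair partitions *)

Section PairPartition.
Context {R : comNzRingType} {n : nat}.
Variable c : 'I_n -> 'I_n -> R.
Hypothesis c_sym : forall p q, c p q = c q p.
Implicit Types (D B : {set 'I_n}) (rho : {set {set 'I_n}}).

(** Relative to a subset [D], so that matched points can be removed in a recursion. *)
Definition pair_part D rho : bool :=
  finset.partition rho D && [forall B in rho, #|B| == 2%N].

(** For a two-element [B] the product has exactly one factor; this reads off the two elements in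
    increasing order without choosing them. *)
Definition pair_weight B : R :=
  \prod_(pq : 'I_n * 'I_n | (pq.1 < pq.2)%N && ([set pq.1; pq.2]%SET == B))
    c pq.1 pq.2.

Definition pairing_sum D : R :=
  \sum_(rho | pair_part D rho) \prod_(B in rho) pair_weight B.

Lemma eq_set2 (p q r s : 'I_n) :
  ([set p; q] == [set r; s])%SET =
  (p == r) && (q == s) || (p == s) && (q == r).
Proof.
apply/eqP/idP => [E|/orP[]/andP[/eqP-> /eqP->] //]; last by rewrite finset.setUC.
have EE z : (z \in [set p; q]%SET) = (z \in [set r; s]%SET) by rewrite E.
move: (EE p) (EE q) (EE r) (EE s).
rewrite !inE !eqxx ?orbT /= [s == p]eq_sym [s == q]eq_sym [r == p]eq_sym [r == q]eq_sym.
by case: (p == r) (p == s) (q == r) (q == s) => -[] [] [].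
Qed.

Lemma pair_weight2 p q : p != q -> pair_weight [set p; q]%SET = c p q.
Proof.
wlog pq : p q / (p < q)%N => [H|] neq.
  have [pq|qp|/val_inj pq] := ssrnat.ltngtP p q; first exact: H.
    by rewrite finset.setUC c_sym; apply: H; rewrite // eq_sym.
  by rewrite pq eqxx in neq.
rewrite /pair_weight (big_pred1 (p, q)) // => -[r s] /=.
rewrite eq_set2 -[RHS]/((r == p) && (s == q)).
apply/idP/idP => [/andP[rs /orP[//|/andP[/eqP rq /eqP sp]]]|/andP[/eqP-> /eqP->]].
  by move: rs; rewrite rq sp ltnNge ltnW.
by rewrite pq !eqxx.
Qed.

Lemma pairing_sum_prod D : pairing_sum D =
  \sum_(rho | pair_part D rho)
     \prod_(p : 'I_n) \prod_(q : 'I_n | (p < q)%N && ([set p; q]%SET \in rho)) c p q.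
Proof.
apply: eq_bigr => rho _.
rewrite (pair_big_dep predT (fun p q : 'I_n => (p < q)%N && ([set p; q]%SET \in rho)) c) /=.
rewrite (partition_big (fun pq : 'I_n * 'I_n => [set pq.1; pq.2]%SET) (mem rho)) /=; last first.
  by move=> pq /andP[].
apply: eq_bigr => B Brho; apply: eq_bigl => pq.
by case: eqP => [->|]; rewrite ?andbT ?andbF ?Brho ?andbT.
Qed.

(** Pair partitions are sorted by the partner [q] of [p]; deleting the block of [p] leaves a pair
    partition of the other points. *)
Lemma pairing_sum_rec D p : p \in D -> pairing_sum D =
  \sum_(q in D :\ p) c p q * pairing_sum (D :\ p :\ q).
Proof.
move=> pD.
have pairP rho : pair_part D rho -> exists2 q, q \in (D :\ p)%SET & [set p; q]%SET \in rho.
  case/andP=> part /'forall_implyP card2; have /and3P[/eqP cov triv _] := part.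
  have pc : p \in finset.cover rho by rewrite cov.
  have /cards2P[x [y [xy E]]] : #|finset.pblock rho p| == 2%N.
    by apply: card2; rewrite finset.pblock_mem.
  have pE : p \in [set x; y]%SET by rewrite -E finset.mem_pblock.
  have sub : [set x; y]%SET \subset D.
    by rewrite -E; apply: (partitionS part); rewrite finset.pblock_mem.
  have Erho : [set x; y]%SET \in rho by rewrite -E finset.pblock_mem.
  move: pE; rewrite !inE => /orP[]/eqP pE; subst p.
    exists y => //; rewrite !inE eq_sym xy; apply: (fintype.subsetP sub).
    by rewrite !inE eqxx orbT.
  exists x; last by rewrite finset.setUC.
  by rewrite !inE xy; apply: (fintype.subsetP sub); rewrite !inE eqxx.
have pairU rho q q' : pair_part D rho -> [set p; q]%SET \in rho -> [set p; q']%SET \in rho ->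
    q != p -> q = q'.
  case/andP=> /and3P[_ triv _] _ qr q'r qp.
  have E : [set p; q]%SET = [set p; q']%SET.
    rewrite -(finset.def_pblock triv qr (x := p)) ?inE ?eqxx //.
    by rewrite -(finset.def_pblock triv q'r (x := p)) ?inE ?eqxx.
  have : q \in [set p; q']%SET by rewrite -E !inE eqxx orbT.
  by rewrite !inE (negPf qp) => /eqP.
(* By [pairP] and [pairU] the inserted inner sum has exactly one term, the partner of [p], so the
   two sums can then be exchanged. *)
transitivity (\sum_(rho | pair_part D rho) \sum_(q in D :\ p | [set p; q] \in rho)
    \prod_(B in rho) pair_weight B)%SET.
  apply: eq_bigr => rho Drho; have [q qD qr] := pairP _ Drho.
  rewrite (big_pred1 q) // => q' /=; apply/andP/eqP => [[q'D q'r]|->//].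
  by apply: (pairU rho) => //; move: q'D; rewrite !inE => /andP[].
rewrite (exchange_big_dep (mem (D :\ p)%SET)) /=; last by move=> rho q _ /andP[].
apply: eq_bigr => q qD; rewrite big_distrr /=.
have /andP[qp qD'] : (q != p) && (q \in D) by move: qD; rewrite !inE.
have Epq : (D :\ p :\ q = D :\: [set p; q])%SET.
  by apply/finset.setP => z; rewrite !inE negb_or andbA [(z != q) && _]andbC.
(* Adding and deleting the block of [p] and [q] are inverse to each other. *)
rewrite (reindex_onto (fun rho => [set p; q]%SET |: rho)%SET
   (fun rho => rho :\ [set p; q]%SET)%SET) /=; last first.
  by move=> rho /andP[_ /andP[_ pqr]]; rewrite finset.setD1K.
have pq0 : [set p; q]%SET != finset.set0.
  by apply/set0Pn; exists p; rewrite !inE eqxx.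
apply: eq_big => rho.
  rewrite /pair_part finset.setU11 qD !andbT /=.
  apply/andP/andP => [[/andP[part card2] /eqP Erho]|[part card2]].
    split; first by rewrite Epq -Erho; apply: partitionD1 => //; rewrite finset.setU11.
    apply/'forall_implyP => B Br; move/'forall_implyP: card2; apply.
    by rewrite !inE Br orbT.
  have pqr : [set p; q]%SET \notin rho.
    apply: contraTN isT => /(partitionS part)/fintype.subsetP/(_ p).
    by rewrite !inE !eqxx /= andbF => /(_ isT).
  split; last by rewrite finset.setU1K.
  apply/andP; split.
    have -> : D = ([set p; q] :|: (D :\ p :\ q))%SET.
      rewrite Epq; apply/finset.setP => z; rewrite !inE.
      by case: (eqVneq z p) => [->|_] //=; case: (eqVneq z q) => [->|].
    apply: partitionU1 => //; rewrite Epq -setI_eq0.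
    by apply/eqP/finset.setP => z; rewrite !inE; case: (_ || _).
  apply/'forall_implyP => B; rewrite !inE => /orP[/eqP->|]; last first.
    by move/'forall_implyP: card2; apply.
  by rewrite cards2 [p == q]eq_sym qp.
move=> /andP[_ /eqP Erho]; rewrite big_setU1 ?pair_weight2 1?eq_sym //=.
by rewrite -Erho !inE eqxx.
Qed.

Lemma pairing_sum0 : pairing_sum finset.set0 = 1.
Proof.
rewrite /pairing_sum (big_pred1 finset.set0) ?big_set0 // => rho.
rewrite /pair_part partition_set0; apply/andP/eqP => [[/eqP//]|->].
by split; [|apply/'forall_implyP => B; rewrite inE].
Qed.

Lemma select_uniq (F : 'I_n -> seq 'I_n -> R) s : uniq s ->
  select F s = \sum_(q <- s) F q (rem q s).
Proof.
elim: s F => [|y t IH] F /=; first by rewrite big_nil.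
case/andP=> yt ut; rewrite big_cons eqxx IH //; congr (_ + _).
apply: eq_big_seq => q qt; case: eqVneq => // yq.
by rewrite yq qt in yt.
Qed.

Lemma enum_setD1 D p : enum (D :\ p)%SET = rem p (enum D).
Proof.
rewrite rem_filter ?enum_uniq // /enum_mem -filter_predI.
by apply: eq_filter => z; rewrite /= !inE.
Qed.

(** Both sides obey the same recursion when [p] is taken to be the first point in the enumeration of
    [D]. *)
Lemma pairing_sum_wick D : pairing_sum D = wick c (enum D).
Proof.
have [m Dm] := ubnP #|D|; elim: m D Dm => [//|m IH] D Dm.
case ED : (enum D) => [|p t].
  have -> : D = finset.set0 by apply/finset.setP => x; rewrite inE -mem_enum ED.
  exact: pairing_sum0.
have uD : uniq (p :: t) by rewrite -ED enum_uniq.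
have pD : p \in D by rewrite -mem_enum ED mem_head.
have Et : enum (D :\ p)%SET = t by rewrite enum_setD1 ED /= eqxx.
rewrite (pairing_sum_rec pD) wick_cons select_uniq; last by case/andP: uD.
rewrite -Et -big_enum /=; apply: eq_big_seq => q; rewrite mem_enum => qD.
rewrite IH ?enum_setD1 //.
by move: Dm; rewrite (cardsD1 p) pD (cardsD1 q (D :\ p)%SET) qD !add1n !ltnS; apply: ltnW.
Qed.

End PairPartition.

(** * Moments of a traceless CCR-GUE matrix *)

Section WickWords.
Context {R : comNzRingType} {I : eqType}.
Variable C : I -> I -> R.
Implicit Types (s t : seq I).

Lemma select_map (J : eqType) (f : J -> I) (F : I -> seq I -> R) r :
  select F (map f r) = select (fun y b => F (f y) (map f b)) r.
Proof. by elim: r F => [//|y r IH] F /=; rewrite IH. Qed.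

Lemma wick_map (J : eqType) (f : J -> I) (r : seq J) :
  wick C (map f r) = wick (fun p q => C (f p) (f q)) r.
Proof.
have [m rm] := ubnP (size r); elim: m r rm => [//|m IH] [//|x r] /= rm.
rewrite !wick_cons select_map; apply: eq_select => y b /perm_size /= yb.
by rewrite IH //; lia.
Qed.

Lemma select_nseq (F : I -> seq I -> R) j y :
  select F (nseq j y) = j%:R * F y (nseq j.-1 y).
Proof.
elim: j F => [|j IH] F /=; first by rewrite mul0r.
rewrite IH; case: j {IH} => [|j]; first by rewrite mul0r addr0 mul1r.
by rewrite -[j.+2]add1n natrD mulrDl mul1r.
Qed.

(** Equal letters cannot be paired, so the pairings of nonzero weight are the bijections from the
    copies of [x] to the copies of [y]. *)
Lemma wick_nseq x y i j : C x x = 0 -> C y y = 0 ->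
  wick C (nseq i x ++ nseq j y) = if i == j then i`!%:R * C x y ^+ i else 0.
Proof.
move=> Cxx Cyy; elim: i j => [|i IH] [|j].
- by rewrite wick_nil mul1r.
- by rewrite [nseq _ _]/= wick_cons select_nseq Cyy mul0r mulr0.
- by rewrite cats0 [nseq _ _]/= wick_cons select_nseq Cxx mul0r mulr0.
rewrite [nseq i.+1 _]/= cat_cons wick_cons select_cat !select_nseq Cxx mul0r mulr0 add0r IH.
rewrite eqSS; case: eqP => [->|_]; last by rewrite !mulr0.
by rewrite factS natrM exprS /=; ring.
Qed.

Lemma wick_flatten (T : eqType) (cl : I -> T) (g : T -> seq I) (e : seq T) :
  (forall x y, cl x != cl y -> C x y = 0) ->
  (forall l, {in g l, forall x, cl x = l}) -> uniq e ->
  wick C (flatten [seq g l | l <- e]) = \prod_(l <- e) wick C (g l).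
Proof.
move=> C0 gl; elim: e => [|l e IH] /=; first by rewrite big_nil.
case/andP => le ue; rewrite big_cons wick_cat ?IH // => x y xl.
move=> /flatten_mapP[l' l'e yl']; apply: C0.
by rewrite (gl _ _ xl) (gl _ _ yl'); apply: contraNneq le => ->.
Qed.

End WickWords.

(** Adjacent exchanges generate all permutations. The length is fixed because in [phi_word] the
    invariance is known only for words of the length under treatment. *)
Lemma perm_swap_subst (V : zmodType) (I : eqType) n (F : seq I -> V) :
  (forall u x y v, size (u ++ x :: y :: v) = n ->
     F (u ++ x :: y :: v) = F (u ++ y :: x :: v)) ->
  forall s t, size s = n -> perm_eq s t -> F s = F t.
Proof.
move=> FE.
have F1 u x s v : size (u ++ x :: s ++ v) = n ->
    F (u ++ x :: s ++ v) = F (u ++ s ++ x :: v).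
  elim: s u => [//|y s IH] u /= un; rewrite FE // -cat_rcons IH ?cat_rcons //.
  by rewrite -un !(size_cat, size_rcons) /= ?size_cat /=; lia.
have F2 u s1 s2 s3 : size (u ++ s1 ++ s2 ++ s3) = n ->
    F (u ++ s1 ++ s2 ++ s3) = F (u ++ s2 ++ s1 ++ s3).
  elim: s1 u => [//|x s1 IH] u /= un.
  rewrite -cat_rcons IH ?cat_rcons // F1 //.
  by rewrite -un !(size_cat, size_rcons) /= ?size_cat /=; lia.
move=> s t sn st.
(* The function is set to zero on words of other lengths, so that the invariance holds for all
   words. *)
have := @catCA_perm_subst _ _ (fun s => if size s == n then F s else 0) _ s t st.
rewrite -(perm_size st) sn eqxx; apply => s1 s2 s3.
rewrite !size_cat addnCA; case: eqP => // ss.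
by apply: (F2 [::]); rewrite !size_cat -ss add0n addnCA.
Qed.

Lemma perm_classes (I : eqType) (T : finType) (cl : I -> T) (s : seq I) :
  perm_eq s (flatten [seq [seq x <- s | cl x == l] | l <- enum T]).
Proof.
apply/seq.permP => a; rewrite count_flatten -map_comp sumnE big_map big_enum /=.
rewrite -sum1_count big_mkcond /=.
transitivity (\sum_(x <- s) \sum_(l : T) (a x && (cl x == l)))%N.
  apply: eq_bigr => x _; rewrite (bigD1 (cl x)) //= eqxx andbT.
  rewrite big1 ?addn0; first by case: (a x).
  by move=> l; rewrite eq_sym => /negPf->; rewrite andbF.
rewrite exchange_big; apply: eq_bigr => l _ /=.
rewrite count_filter -sum1_count [RHS]big_mkcond.
by apply: eq_bigr => x _ /=; case: (_ && _).
Qed.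

(* [M a b] has the moments of the matrix unit [E b a], centred, in the state
   given by the density matrix [diag w]. *)
Definition entry_cov (R : realType) (d : nat) (w : 'I_d -> R) (x y : 'I_d * 'I_d) : R :=
  ((x.1 == y.2) && (x.2 == y.1))%:R * w x.2 -
  ((x.1 == x.2) && (y.1 == y.2))%:R * (w x.1 * w y.1).

(** An entry and its transpose get the same class. On the diagonal [insub] fails, which yields the
    index [None] of the diagonal algebra. *)
Definition entry_class (d : nat) (x : 'I_d * 'I_d) : option (upper_index d) :=
  if (x.1 < x.2)%N then (insub x : option (upper_index d))
  else (insub (x.2, x.1) : option (upper_index d)).

Section Realization.
Context {R : realType} {d : nat} {w : 'I_d -> R} {A : algType R[i]}.
Context {star : A -> A} {phi : {scalar A}} {M : 'M[A]_d}.
Hypothesis phiP : is_star_prob_space star phi.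
Hypothesis MP : traceless_ccr_gue star phi w M.
Implicit Types (x y : 'I_d * 'I_d) (s t : seq ('I_d * 'I_d)).

Local Notation C := (entry_cov w).
Local Notation word s := (\prod_(x <- s) M x.1 x.2).

Lemma entry_class_diag x : (entry_class x == None) = (x.1 == x.2).
Proof.
rewrite /entry_class; case: (ssrnat.ltngtP x.1 x.2) => [lt|lt|/val_inj ->].
- by rewrite insubT /=; apply/esym; apply: contraTF lt => /eqP ->; rewrite ltnn.
- by rewrite insubT /=; apply/esym; apply: contraTF lt => /eqP ->; rewrite ltnn.
- by rewrite insubF ?eqxx //= ltnn.
Qed.

Lemma entry_class_some x p : entry_class x = Some p ->
  x = val p \/ x = ((val p).2, (val p).1).
Proof.
rewrite /entry_class; case: ifP => _; case: insubP => // u _ ux [<-]; rewrite ux.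
  by left.
by right; case: (x).
Qed.

Lemma entry_cov_class x y : entry_class x != entry_class y -> C x y = 0.
Proof.
rewrite /entry_cov => xy.
have -> : (x.1 == x.2) && (y.1 == y.2) = false.
  by apply: contraNF xy; rewrite -!entry_class_diag => /andP[/eqP-> /eqP->].
have -> : (x.1 == y.2) && (x.2 == y.1) = false; last by rewrite !mul0r subrr.
apply: contraNF xy; case: x => x1 x2; case: y => a b /= /andP[/eqP-> /eqP->].
by rewrite /entry_class /=; case: (ssrnat.ltngtP a b) => // /val_inj ->.
Qed.

Lemma entry_mem (B : option (upper_index d) -> set A) x :
  (forall l, is_star_subalg star (B l)) ->
  (forall p : upper_index d, B (Some p) (M (val p).1 (val p).2) /\
     M (val p).2 (val p).1 = star (M (val p).1 (val p).2)) ->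
  (forall i, B None (M i i)) -> B (entry_class x) (M x.1 x.2).
Proof.
move=> Bsub Bpair Bdiag; case E : (entry_class x) => [p|].
  have [Bp Mp] := Bpair p; have [_ _ _ Bstar] := Bsub (Some p).
  by case: (entry_class_some E) => -> //=; rewrite Mp; exact: Bstar.
by move/eqP: E; rewrite entry_class_diag => /eqP ->; exact: Bdiag.
Qed.

(** Entries of different algebras commute by independence and have zero covariance; diagonal entries
    commute and have symmetric covariance; an off-diagonal entry and its adjoint satisfy the CCR,
    whose constant is the difference of the two weights. *)
Lemma entry_swap x y :
  M x.1 x.2 * M y.1 y.2 = M y.1 y.2 * M x.1 x.2 + ((C x y - C y x)%:C)%:A.
Proof.
have [B [Bsub [Bcom Bind] Bpair Bdiag [Md _]]] := MP.
have Bmem z : B (entry_class z) (M z.1 z.2).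
  by apply: entry_mem => // q; have := Bpair q; case: (val q) => ? ? [].
have [E|/eqP ne] := eqVneq (entry_class x) (entry_class y); last first.
  rewrite !entry_cov_class ?subrr ?scale0r ?addr0; first exact: Bcom ne _ _.
    by rewrite eq_sym; exact/eqP.
  exact/eqP.
case Ex : (entry_class x) (E) => [p|] Ey; last first.
  rewrite (Bdiag (M x.1 x.2) (M y.1 y.2)); [|by rewrite -Ex|by rewrite Ey].
  move/eqP: Ex; rewrite entry_class_diag => /eqP Ex.
  move/esym/eqP: Ey; rewrite entry_class_diag => /eqP Ey.
  rewrite /entry_cov Ex Ey /=; case: (eqVneq x.2 y.2) => [->|]; rewrite ?subrr ?scale0r ?addr0 //.
  move=> _; rewrite /= !mul0r !eqxx [w y.2 * _]mulrC.
  by rewrite subrr scale0r addr0.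
have := Bpair p; have := valP p.
case: (val p) (entry_class_some Ex) (entry_class_some (esym Ey)) => i j /= xE yE ij.
have ijF : (i == j) = false by apply: contraTF ij => /eqP ->; rewrite ltnn.
have jiF : (j == i) = false by rewrite eq_sym.
case=> _ [_ _ rel _] Ms.
case: xE => ->; case: yE => ->; rewrite /entry_cov /= ?Ms ?eqxx ?ijF ?jiF /=.
- by rewrite subrr scale0r addr0.
- rewrite rel -addrA -scalerDl -rmorphD /=.
  by rewrite (_ : _ + _ = 0) ?scale0r ?addr0 //; ring.
- by rewrite rel; congr (_ + _%:A); congr (_%:C); ring.
- by rewrite subrr scale0r addr0.
Qed.

(** On diagonal entries the covariance is symmetric, so the ordered sum [wick] agrees with the
    Gaussian sum over pair partitions. *)
Lemma phi_word_diag s : all (fun x => x.1 == x.2) s ->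
  phi (word s) = (wick C s)%:C.
Proof.
have [B [_ _ _ _ [_ [_ gauss]]]] := MP.
case: s => [|x0 s'] sd; first by rewrite big_nil; have [_ ->] := phiP.
set s := x0 :: s' in sd *; pose f (j : 'I_(size s)) := tnth (in_tuple s) j.
have fd j : (f j).1 = (f j).2 by apply/eqP; exact: (allP sd _ (mem_tnth j (in_tuple s))).
rewrite big_tnth (eq_bigr (fun j => M (f j).1 (f j).1)); last first.
  by move=> j _; rewrite -/(f j) fd.
have {}gauss := gauss (size s) (fun j => (f j).1) isT.
rewrite gauss; congr (_%:C).
have c_sym (p q : 'I_(size s)) : C (f p) (f q) = C (f q) (f p).
  rewrite /entry_cov !fd !eqxx /= !mul1r [w (f q).2 * _]mulrC.
  case: (eqVneq (f p).2 (f q).2) => [->|] //= _; by rewrite ?andbF ?mul0r.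
(* The word may repeat letters, so pairings are counted on positions and only then mapped to
   letters. *)
have sE : s = [seq f j | j <- enum [set: 'I_(size s)]%SET].
  rewrite -[LHS](map_tnth_enum (in_tuple s)); congr map.
  by apply/esym; rewrite enum_setT enumT.
transitivity (wick C [seq f j | j <- enum [set: 'I_(size s)]%SET]); last by rewrite -sE.
rewrite wick_map -(pairing_sum_wick c_sym) pairing_sum_prod.
apply: eq_big => [//|rho _]; apply: eq_bigr => p _; apply: eq_bigr => q _.
rewrite mxE /entry_cov !fd !eqxx andbb /=.
case: (eqVneq (f p).2 (f q).2) => [->|]; rewrite ?eqxx ?mul1r ?expr2 //.
by rewrite mul0r sub0r ?mul1r.
Qed.

(** By [entry_swap] and [wick_swap], exchanging adjacent letters changes both sides by the same
    multiple of their values on a shorter word, so by induction on the length the letters may be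
    sorted. On a word sorted by class both sides factor, and within one class the moments are given
    by the Gaussian assumptions. *)
Lemma phi_word s : phi (word s) = (wick C s)%:C.
Proof.
have [m sm] := ubnP (size s); elim: m s sm => [//|m IH] s sm.
pose D t := phi (word t) - (wick C t)%:C.
have perm_phi t : perm_eq s t -> phi (word t) = (wick C t)%:C ->
    phi (word s) = (wick C s)%:C.
  move=> st tE; apply/eqP; rewrite -subr_eq0 -/(D s).
  rewrite (@perm_swap_subst _ _ (size s) D _ s t) /D ?tE ?subrr //.
  move=> u x y v un.
  have ctr : word (u ++ x :: y :: v) =
      word (u ++ y :: x :: v) + (C x y - C y x)%:C *: word (u ++ v).
    rewrite !big_cat /= !big_cons (mulrA (M x.1 x.2)) entry_swap mulrDl mulrDr.
    by rewrite -(mulrA (M y.1 y.2)) -scalerAl mul1r -scalerAr.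
  rewrite /D ctr linearD linearZ /= wick_swap.
  rewrite [(wick _ _ + _)%:C]rmorphD /= [in X in _ - X]rmorphM /=.
  rewrite (IH (u ++ v)); first by ring.
  by move: sm; rewrite -un !size_cat /=; lia.
have [B [Bsub [Bcom Bind] Bpair Bdiag [Md _]]] := MP.
have Bmem z : B (entry_class z) (M z.1 z.2).
  by apply: entry_mem => // q; have := Bpair q; case: (val q) => ? ? [].
have Bword l t : {in t, forall x, entry_class x = l} -> B l (word t).
  elim: t => [|x t IHt] tl; first by rewrite big_nil; case: (Bsub l).
  rewrite big_cons; have [_ _ BM _] := Bsub l; apply: BM.
    by rewrite -(tl x) ?mem_head.
  by apply: IHt => y yt; apply: tl; rewrite inE yt orbT.
pose g l := [seq x <- s | entry_class x == l].
have gl l : {in g l, forall x, entry_class x = l}.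
  by move=> x; rewrite mem_filter => /andP[/eqP].
have phi_g l : phi (word (g l)) = (wick C (g l))%:C.
  (* If the class does not exhaust the word, its subword is shorter and the induction hypothesis
     applies; otherwise all letters lie in one algebra. *)
  have [gs|] := ltnP (size (g l)) (size s); first by apply: IH; lia.
  rewrite size_filter => sg.
  have gE : g l = s.
    by apply/all_filterP; rewrite all_count eqn_leq sg count_size.
  case: l gE {sg} => [p|] gE; last first.
    apply: phi_word_diag; apply/allP => x /gl /eqP.
    by rewrite entry_class_diag.
  rewrite gE; set x := val p; pose x' := (x.2, x.1).
  (* Only an entry and its adjoint occur; sorting them gives the normally ordered moment known from
     [ccr_complex_gaussian]. *)
  apply: (perm_phi (nseq (count_mem x s) x ++ nseq (count (predC1 x) s) x')).
    apply: (@perm_trans _ (seq.filter (pred1 x) s ++ seq.filter (predC1 x) s)).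
      by rewrite perm_sym perm_filterC.
    apply: perm_cat.
      by rewrite -size_filter; have /all_pred1P <- := filter_all (pred1 x) s.
    have /all_pred1P : all (pred1 x') (seq.filter (predC1 x) s).
      apply/allP => y; rewrite mem_filter => /andP[yx ys] /=; apply/eqP.
      have [yE|//] : y = x \/ y = x' by apply: entry_class_some; apply: gl; rewrite gE.
      by rewrite yE /= eqxx in yx.
    by rewrite size_filter => <-.
  have := Bpair p; have := valP p; rewrite /x' -/x.
  case: (x) => i j /= ij [_ [_ _ _ momE] Mji].
  have ijF : (i == j) = false by apply: contraTF ij => /eqP ->; rewrite ltnn.
  rewrite big_cat /= !big_nseq !iter_mulr_1 Mji momE wick_nseq; last 2 first.
  - by rewrite /entry_cov /= [j == i]eq_sym ijF /= !mul0r subrr.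
  - by rewrite /entry_cov /= [j == i]eq_sym ijF /= !mul0r subrr.
  rewrite /entry_cov /= !eqxx ijF /= mul0r subr0 mul1r.
  by case: ifP.
apply: (perm_phi (flatten [seq g l | l <- enum {: option (upper_index d)}])).
  exact: perm_classes.
rewrite (wick_flatten entry_cov_class) ?enum_uniq //.
rewrite big_flatten big_map big_tnth
  (Bind _ (tnth (in_tuple (enum {: option (upper_index d)})))); last 2 first.
- move=> i j; rewrite !(tnth_nth None) /= => /eqP.
  by rewrite nth_uniq ?enum_uniq // => /eqP/val_inj.
- by move=> j; apply: Bword; exact: gl.
rewrite rmorph_prod [in RHS]big_tnth; apply: eq_bigr => j _; exact: phi_g.
Qed.

End Realization.

(** * The character as a sum over colourings *)

Section CharacterFormula.
Context {R : realType} {d : nat} {w : 'I_d -> R}.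

(** A colouring fixed by [s] is a free choice of one colour per orbit, and an orbit of colour [a]
    contributes [w a] to the power of its size. Expanding the product over the orbits lists these
    choices. *)
Lemma sum_ffun_porbits (T : finType) (s : {perm T}) (a0 : 'I_d) :
  \sum_(f : {ffun T -> 'I_d} | [forall x, f (s x) == f x]) \prod_x w (f x) =
  \prod_(V in porbits s) psum w #|V|.
Proof.
pose P : {set {set T}} := porbits s.
have orbP x : porbit s x \in P by exact: imset_f.
rewrite /psum (big_distr_big a0) /=.
pose h (g : {ffun {set T} -> 'I_d}) : {ffun T -> 'I_d} := [ffun x => g (porbit s x)].
(* The colour [a0] on sets that are not orbits is the default value that the partial functions of
   [big_distr_big] take outside their domain. *)
pose h' (f : {ffun T -> 'I_d}) : {ffun {set T} -> 'I_d} :=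
  [ffun V => if V \in P then if [pick x in V] is Some x then f x else a0 else a0].
rewrite (reindex_onto h h') /=; last first.
  move=> f /forallP sf; apply/ffunP => x; rewrite !ffunE orbP.
  case: pickP => [y|/(_ x)]; last by rewrite porbit_id.
  case/porbitP => i ->; elim: i => [|i IH]; first by rewrite perm1.
  by rewrite expgSr permM (eqP (sf _)).
apply: eq_big => g.
  apply/andP/pffun_onP => [[_ /eqP <-]|[gP _]].
    split=> [|//]; apply/supportP => V VP; by rewrite ffunE (negPf VP).
  split.
    by apply/forallP => x; rewrite !ffunE (porbit_perm s 1 x).
  apply/eqP/ffunP => V; rewrite !ffunE; case: ifPn => VP; last first.
    by rewrite (supportP gP).
  have /imsetP[x _ VE] := VP.
  case: pickP => [y|/(_ x)]; last by rewrite VE porbit_id.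
  by rewrite VE -eq_porbit_mem => /eqP yx; rewrite ffunE yx.
move=> _; rewrite (partition_big (porbit s) (mem P)) //=.
apply: eq_bigr => V VP; under eq_bigr => x /eqP xV do rewrite ffunE xV.
rewrite prodr_const; congr (_ ^+ _); apply: eq_card => x.
have /imsetP[y _ ->] := VP.
by rewrite -eq_porbit_mem.
Qed.

Lemma card_fset_set_image (N : nat) (V : {set 'I_N}) :
  #|` fset_set [set n | exists2 i, i \in V & val i = n] | = #|V|.
Proof.
rewrite (_ : [set n | _] = [set` [fset x in [seq val i | i <- enum V]]%fset]).
  rewrite set_fsetK card_fseq undup_id ?size_map -?cardE //.
  by rewrite map_inj_uniq ?enum_uniq //; exact: val_inj.
apply/seteqP; split => n /=.
  by move=> [i iV <-]; rewrite !inE; apply: map_f; rewrite mem_enum.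
by rewrite !inE => /mapP[j]; rewrite mem_enum => jV ->; exists j.
Qed.

Hypothesis w1 : \sum_i w i = 1.

(** All moved points lie below [N], so [s] restricts to a permutation of ['I_N] and the sum over
    colourings factors over its orbits. Fixed points contribute the sum of the weights, which is
    1. *)
Lemma chiE (a0 : 'I_d) (s : Sinf) N : (forall n, (N <= n)%N -> s n = n) ->
  chi w s = \sum_(f : {ffun 'I_N -> 'I_d} |
      [forall i : 'I_N, forall j : 'I_N, (s i == j :> nat) ==> (f j == f i)])
    \prod_i w (f i).
Proof.
move=> sN.
have s_lt n : (n < N)%N -> (s n < N)%N.
  rewrite !ltnNge; apply: contra => Nsn.
  by rewrite -(can_inj (@sinf_funK s) (sN _ Nsn)).
pose g (i : 'I_N) := Ordinal (s_lt i (ltn_ord i)).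
have g_inj : injective g.
  by move=> i j [] /(can_inj (@sinf_funK s)) /val_inj.
pose sp := perm g_inj.
have spE i k : val ((sp ^+ k)%g i) = iter k s i.
  elim: k => [|k IH]; first by rewrite perm1.
  by rewrite expgSr permM /= -IH permE.
transitivity (\sum_(f : {ffun 'I_N -> 'I_d} | [forall x, f (sp x) == f x])
    \prod_x w (f x)); last first.
  apply: eq_bigl => f; apply/forallP/forallP => sf i.
    apply/forallP => j; apply/implyP => /eqP sij.
    by rewrite -(eqP (sf i)); apply/eqP; congr (f _); apply/val_inj; rewrite permE.
  by have /forallP /(_ (g i)) := sf i; rewrite permE eqxx.
rewrite (sum_ffun_porbits _ a0).
pose e (V : {set 'I_N}) : set nat := [set n | exists2 i, i \in V & val i = n].
have e_inj : injective e.
  move=> V V' /seteqP[VV' V'V]; apply/finset.setP => i; apply/idP/idP => iV.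
    by have [|j jV' /val_inj <-] := VV' (val i); [exists i|].
  by have [|j jV' /val_inj <-] := V'V (val i); [exists i|].
have orbE (i : 'I_N) : sinf_orbit s i = e (porbit sp i).
  apply/seteqP; split => n /=.
    move=> [k [->|ik]].
      by exists ((sp ^+ k)%g i); rewrite ?mem_porbit ?spE.
    have nN : (n < N)%N.
      rewrite ltnNge; apply: contraTN (ltn_ord i) => Nn.
      have -> : nat_of_ord i = n.
        by rewrite ik; elim: (k) => //= k' ->; exact: sN.
      by rewrite -leqNgt.
    exists (Ordinal nN) => //; rewrite porbit_sym; apply/porbitP; exists k.
    by apply: val_inj; rewrite spE.
  by move=> [j /porbitP[k ->] <-]; exists k; left; rewrite spE.
have moE : moved_orbits s = [set` [seq e V | V <- enum [set V in porbits sp | (1 < #|V|)%N]%SET]].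
  apply/seteqP; split => V /=.
    move=> [[n ->]]; have [nN|Nn] := ltnP n N.
      rewrite (orbE (Ordinal nN)) card_fset_set_image => c2.
      by apply: map_f; rewrite mem_enum !inE c2 andbT; exact: imset_f.
    (* Points from [N] on are fixed, also under backward iteration, so their orbits are singletons
       and do not count as moved. *)
    have -> : sinf_orbit s n = [set n].
      apply/seteqP; split => m /=; last by move=> ->; exists 0%N; left.
      have itn k : iter k s n = n by elim: k => //= k ->; exact: sN.
      move=> [k [->|nk]]; first exact: itn.
      have skK : cancel (iter k s) (iter k (sinf_inv s)).
        move=> x; elim: k {nk} => //= k IH; by rewrite -[LHS]/(iter k.+1 _ _) iterSr sinf_funK.
      by apply: (can_inj skK); rewrite -nk itn.
    by rewrite fset_set1 cardfs1.
  move=> /mapP[W]; rewrite mem_enum !inE => /andP[/imsetP[i _ ->] c2] ->.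
  split; last by rewrite card_fset_set_image.
  by exists i; rewrite orbE.
rewrite /chi moE -fsbig_seq; last by rewrite map_inj_uniq ?enum_uniq.
rewrite big_map big_enum /= [RHS](bigID (fun V : {set 'I_N} => (1 < #|V|)%N)) /=.
rewrite [X in _ = _ * X]big1 ?mulr1 => [|V /andP[VP V1]].
  by apply: eq_big => [V|V _]; rewrite ?inE // card_fset_set_image.
suff -> : #|V| = 1%N by rewrite /psum -[RHS]w1; apply: eq_bigr.
have /imsetP[i _ Vi] := VP.
by apply/eqP; rewrite eqn_leq -ltnS ltnNge V1 /= lt0n Vi card_porbit_neq0.
Qed.

End CharacterFormula.

(** * The tensor model *)

(* [Swap v] stands for the transposition of the points 0 and [v.+1], [Mean] for
   the mean of these transpositions, [Fluct n] for the sum of [Swap v - Mean]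
   over [v < n]. *)
Inductive letter := Swap of nat | Mean | Fluct of nat.

Definition letter_lt (N : nat) (l : letter) : bool :=
  match l with Swap v => (v < N)%N | Mean => true | Fluct n => (n <= N)%N end.

Definition is_fluct (l : letter) : bool := if l is Fluct _ then true else false.

Definition set_slot (T : Type) (m : nat -> T) (v : nat) (X : T) : nat -> T :=
  fun u => if u == v then X else m u.

Section SetSlot.
Context {T : Type}.
Implicit Types (m : nat -> T) (v u : nat) (X Y : T).

Lemma set_slot_same m v X : set_slot m v X v = X.
Proof. by rewrite /set_slot eqxx. Qed.

Lemma set_slotK m v : set_slot m v (m v) = m.
Proof. by apply/funext => u; rewrite /set_slot; case: eqP => [->|]. Qed.

Lemma set_slot_set m v X Y : set_slot (set_slot m v X) v Y = set_slot m v Y.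
Proof. by apply/funext => u; rewrite /set_slot; case: eqP. Qed.

Lemma set_slotC m v u X Y : u != v ->
  set_slot (set_slot m v X) u Y = set_slot (set_slot m u Y) v X.
Proof.
move=> uv; apply/funext => z; rewrite /set_slot.
by case: (eqVneq z u) => // ->; rewrite (negPf uv).
Qed.

End SetSlot.

Section SlotModel.
Context {R : realType} {d : nat} (w : 'I_d -> R).
Implicit Types (t : seq letter) (a b c : 'I_d) (v n N : nat).

(* the (a, c) entry, at one slot, of the transposition minus its mean *)
Definition centred_unit (x : 'I_d * 'I_d) : 'M[R]_d :=
  delta_mx x.2 x.1 - ((x.1 == x.2)%:R * w x.1)%:M.

(* The (a, b) entry, with respect to the point 0, of the operator given by a
   word; [m] collects the factors at the other points. *)
Fixpoint walk (p : nat) (fin : (nat -> 'M[R]_(p, d)) -> R) t a b m : R :=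
  match t with
  | [::] => (a == b)%:R * fin m
  | Swap v :: t' =>
      \sum_c walk fin t' c b (set_slot m v (m v *m delta_mx c a))
  | Mean :: t' => w a * walk fin t' a b m
  | Fluct n :: t' =>
      \sum_(v < n) \sum_c walk fin t' c b (set_slot m v (m v *m centred_unit (a, c)))
  end.

Section Linear.
Context {p : nat} {fin : (nat -> 'M[R]_(p, d)) -> R} {N : nat}.
Implicit Types (m : nat -> 'M[R]_(p, d)) (X Y : 'M[R]_(p, d)).
Hypothesis fin_lin : forall m v k X Y, (v < N)%N ->
  fin (set_slot m v (k *: X + Y)) = k * fin (set_slot m v X) + fin (set_slot m v Y).

Lemma walk_lin t a b m v k X Y : (v < N)%N ->
  walk fin t a b (set_slot m v (k *: X + Y)) =
  k * walk fin t a b (set_slot m v X) + walk fin t a b (set_slot m v Y).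
Proof.
move=> vN; elim: t a m X Y => [|l t IH] a m X Y /=.
  by rewrite fin_lin //; ring.
have step (Z : 'M[R]_d) c u :
    walk fin t c b (set_slot (set_slot m v (k *: X + Y)) u
                      (set_slot m v (k *: X + Y) u *m Z)) =
    k * walk fin t c b (set_slot (set_slot m v X) u (set_slot m v X u *m Z)) +
    walk fin t c b (set_slot (set_slot m v Y) u (set_slot m v Y u *m Z)).
  case: (eqVneq u v) => [->|uv].
    by rewrite !set_slot_same !set_slot_set mulmxDl -scalemxAl IH.
  have E W : set_slot m v W u = m u by rewrite /set_slot (negPf uv).
  by rewrite !E !(set_slotC _ _ _ uv) IH.
case: l => [u| |n].
- by rewrite mulr_sumr -big_split; apply: eq_bigr => c _; exact: step.
- by rewrite IH; ring.
- rewrite mulr_sumr -big_split; apply: eq_bigr => u _.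
  by rewrite mulr_sumr -big_split; apply: eq_bigr => c _; exact: step.
Qed.

(** At slot [v] the centred unit is the matrix unit of the transposition minus a multiple of the
    identity. By linearity in the slot, the second part leaves the slot unchanged and survives only
    for [c = a], where it gives [Mean]. *)
Lemma walk_fluct u n t a b m : (n <= N)%N ->
  walk fin (u ++ Fluct n :: t) a b m =
  \sum_(v < n) (walk fin (u ++ Swap v :: t) a b m - walk fin (u ++ Mean :: t) a b m).
Proof.
move=> nN; elim: u a m => [|l u IH] a m /=.
  apply: eq_bigr => v _; have vN := leq_trans (ltn_ord v) nN.
  pose X c := m v *m delta_mx c a.
  transitivity (\sum_c (walk fin t c b (set_slot m v (X c)) -
      ((a == c)%:R * w a) * walk fin t c b m)).
    apply: eq_bigr => c _; rewrite /centred_unit mulmxBr mul_mx_scalar /= addrC -scaleNr.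
    by rewrite walk_lin // set_slotK addrC mulNr.
  rewrite sumrB; congr (_ - _); rewrite (bigD1 a) //= eqxx mul1r big1 ?addr0 // => c ca.
  by rewrite eq_sym (negPf ca) !mul0r.
case: l => [v| |n'].
- rewrite (eq_bigr _ (fun c _ => IH c _)) exchange_big /=.
  by apply: eq_bigr => i _; rewrite -sumrB.
- by rewrite IH mulr_sumr; apply: eq_bigr => v _; rewrite mulrBr.
- under eq_bigr => v' _ do under eq_bigr => c _ do rewrite IH.
  under eq_bigr do rewrite exchange_big /=.
  rewrite exchange_big /=; apply: eq_bigr => v _.
  by rewrite -sumrB; apply: eq_bigr => v' _; rewrite -sumrB.
Qed.

End Linear.

Definition slot_state (X : 'M[R]_d) : R := \sum_b w b * X b b.

Definition product_state N (m : nat -> 'M[R]_d) : R := \prod_(v < N) slot_state (m v).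

Definition unit_moment (s : seq ('I_d * 'I_d)) : R :=
  slot_state (foldr (fun x X => centred_unit x *m X) 1%:M s).

Definition model N t : R :=
  \sum_a w a * walk (product_state N) t a a (fun=> 1%:M).

Lemma product_state_lin N (m : nat -> 'M[R]_d) v k X Y : (v < N)%N ->
  product_state N (set_slot m v (k *: X + Y)) =
  k * product_state N (set_slot m v X) + product_state N (set_slot m v Y).
Proof.
move=> vN.
have E Z : product_state N (set_slot m v Z) =
    slot_state Z * \prod_(i < N | i != Ordinal vN) slot_state (m i).
  rewrite /product_state (bigD1 (Ordinal vN)) //= set_slot_same; congr (_ * _).
  apply: eq_bigr => i iv; rewrite /set_slot ifF //.
  by apply: contraNF iv => /eqP iv; apply/eqP/val_inj.
rewrite !E /slot_state mulrA -mulrDl; congr (_ * _).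
by rewrite mulr_sumr -big_split; apply: eq_bigr => b _; rewrite !mxE /=; ring.
Qed.

Lemma model_fluct N u n t : (n <= N)%N ->
  model N (u ++ Fluct n :: t) =
  \sum_(v < n) (model N (u ++ Swap v :: t) - model N (u ++ Mean :: t)).
Proof.
move=> nN; rewrite /model.
under eq_bigr do rewrite (walk_fluct (@product_state_lin N)) // mulr_sumr.
rewrite exchange_big /=; apply: eq_bigr => v _.
by rewrite -sumrB; apply: eq_bigr => a _; rewrite mulrBr.
Qed.

Hypothesis w1 : \sum_i w i = 1.

Lemma slot_state1 : slot_state 1%:M = 1.
Proof. by rewrite -[RHS]w1; apply: eq_bigr => b _; rewrite mxE eqxx mulr1. Qed.

Lemma slot_state_unit a c : slot_state (delta_mx c a) = (a == c)%:R * w a.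
Proof.
rewrite /slot_state (bigD1 a) //= big1 ?addr0 ?mxE ?eqxx ?andbT 1?mulrC // => b ba.
by rewrite mxE (negPf ba) andbF mulr0.
Qed.

Lemma walk_ext N t a b (m m' : nat -> 'M[R]_d) : all (letter_lt N) t ->
  (forall v, (v < N)%N -> m v = m' v) ->
  walk (product_state N) t a b m = walk (product_state N) t a b m'.
Proof.
elim: t a m m' => [|l t IH] a m m' /=.
  move=> _ mm'; congr (_ * _); apply: eq_bigr => v _; by rewrite mm'.
case/andP => lN tN mm'.
have step v (vN : (v < N)%N) (Z : 'M[R]_d) c :
    walk (product_state N) t c b (set_slot m v (m v *m Z)) =
    walk (product_state N) t c b (set_slot m' v (m' v *m Z)).
  apply: IH => // u uN; rewrite /set_slot mm' //; case: eqP => // _.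
  exact: mm'.
case: l lN => [v| |n] /= lN.
- by apply: eq_bigr => c _; exact: step.
- by rewrite (IH _ m m').
- apply: eq_bigr => v _; apply: eq_bigr => c _; apply: step.
  exact: leq_trans (ltn_ord v) lN.
Qed.

(** The word never touches the slots from [N] on: those before [j] still hold the identity, of state
    1, and slot [j] only contributes its own state. *)
Lemma walk_widen N j t a b (m : nat -> 'M[R]_d) : all (letter_lt N) t -> (N <= j)%N ->
  (forall v, (N <= v < j)%N -> m v = 1%:M) ->
  walk (product_state j.+1) t a b m =
  slot_state (m j) * walk (product_state N) t a b m.
Proof.
move=> tN Nj; elim: t a m tN => [|l t IH] a m /=.
  move=> _ m1; rewrite mulrCA; congr (_ * _); rewrite /product_state big_ord_recr mulrC /=.
  congr (_ * _).
  rewrite -(big_mkord predT (fun v => slot_state (m v))) (@big_cat_nat _ _ _ N) //=.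
  rewrite [X in _ * X]big_nat_cond [X in _ * X]big1 ?mulr1 ?big_mkord // => v.
  by rewrite andbT => /m1 ->; rewrite slot_state1.
case/andP => lN tN m1.
have step v (vN : (v < N)%N) (Z : 'M[R]_d) c :
    walk (product_state j.+1) t c b (set_slot m v (m v *m Z)) =
    slot_state (m j) * walk (product_state N) t c b (set_slot m v (m v *m Z)).
  rewrite IH //; first by rewrite {1}/set_slot gtn_eqF // (leq_trans vN).
  move=> u /andP[Nu uj]; rewrite /set_slot gtn_eqF ?m1 ?Nu //.
  exact: leq_trans vN Nu.
case: l lN => [v| |n] /= lN.
- by rewrite mulr_sumr; apply: eq_bigr => c _; exact: step.
- by rewrite IH // mulrCA.
- rewrite mulr_sumr; apply: eq_bigr => v _; rewrite mulr_sumr; apply: eq_bigr => c _.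
  by apply: step; exact: leq_trans (ltn_ord v) lN.
Qed.

(** Slot [j] meets no other letter, so it ends up holding a single matrix unit [delta_mx c a]. Its
    state vanishes unless [c = a] and is then [w a], which is the action of [Mean]. *)
Lemma model_fresh N j u t : all (letter_lt N) u -> all (letter_lt N) t -> (N <= j)%N ->
  model j.+1 (u ++ Swap j :: t) = model N (u ++ Mean :: t).
Proof.
(* The end colour [b] is separated from the start colour, and [m] is kept arbitrary below [N],
   because the letters of [u] change both the start colour and the slots. *)
move=> uN tN Nj; apply: eq_bigr => a0 _; congr (_ * _); move: {2 4}a0 => b.
set m := fun=> _; have m1 v : (N <= v)%N -> m v = 1%:M by [].
clearbody m; move: m1.
elim: u a0 m uN => [|l u IH] a m /= uN m1.
  transitivity (\sum_c (a == c)%:R * w a * walk (product_state N) t c b m).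
    apply: eq_bigr => c _; rewrite m1 // mul1mx (walk_widen _ _ tN) //.
      rewrite set_slot_same slot_state_unit; congr (_ * _); apply: walk_ext => // v vN.
      by rewrite /set_slot ltn_eqF // (leq_trans vN).
    move=> v /andP[Nv vj]; by rewrite /set_slot ltn_eqF // m1.
  rewrite (bigD1 a) //= eqxx mul1r big1 ?addr0 // => c ca.
  by rewrite eq_sym (negPf ca) !mul0r.
case/andP: uN => lN uN.
have step v (vN : (v < N)%N) (Z : 'M[R]_d) c :
    walk (product_state j.+1) (u ++ Swap j :: t) c b (set_slot m v (m v *m Z)) =
    walk (product_state N) (u ++ Mean :: t) c b (set_slot m v (m v *m Z)).
  apply: IH => // x Nx; rewrite /set_slot gtn_eqF ?m1 //; exact: leq_trans vN Nx.
case: l lN => [v| |n] /= lN.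
- by apply: eq_bigr => c _; exact: step.
- by rewrite IH.
- apply: eq_bigr => v _; apply: eq_bigr => c _; apply: step.
  exact: leq_trans (ltn_ord v) lN.
Qed.

End SlotModel.

Lemma split_sum_big (R : comNzRingType) (I : eqType) (J : Type) (r : seq J)
    (F : J -> seq I -> seq I -> R) (s : seq I) :
  split_sum (fun a b => \sum_(j <- r) F j a b) s = \sum_(j <- r) split_sum (F j) s.
Proof.
by elim: s F => [//|x s IH] F /=; rewrite !IH big_split.
Qed.

Section SlotModelValues.
Context {R : realType} {d : nat} {w : 'I_d -> R}.
Implicit Types (t : seq letter) (a b c : 'I_d) (v n N : nat).

Local Notation walk := (@walk R d w).
Local Notation product_state := (@product_state R d w).
Local Notation slot_state := (@slot_state R d w).

Definition swaps_perm (vs : seq nat) : Sinf := foldr (fun v (s : Sinf) => gamma v.+1 * s)%g 1%g vs.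

Lemma swaps_perm_lt vs N n : all (fun v => v < N)%N vs -> (n <= N)%N -> (swaps_perm vs n <= N)%N.
Proof.
move=> + nN; elim: vs => [//|v vs IH] /= /andP[vN /IH]; rewrite /swap0 /=.
by case: eqP => // _; case: eqP.
Qed.

Lemma swaps_perm_fix vs N n : all (fun v => v < N)%N vs -> (N < n)%N -> swaps_perm vs n = n.
Proof.
move=> + Nn; elim: vs => [//|v vs IH] /= /andP[vN /IH ->]; rewrite /swap0 /=.
by rewrite !gtn_eqF // (leq_trans _ Nn) // ltnS ltnW.
Qed.

(** The coefficient of a tensor of row vectors at the basis tensor with colours [G]; slot [v] is the
    point [v.+1]. *)
Definition config_state N (G : nat -> 'I_d) (m : nat -> 'rV[R]_d) : R :=
  \prod_(v < N) m v ord0 (G v.+1).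

Lemma config_state_lin N G (m : nat -> 'rV[R]_d) v k X Y : (v < N)%N ->
  config_state N G (set_slot m v (k *: X + Y)) =
  k * config_state N G (set_slot m v X) + config_state N G (set_slot m v Y).
Proof.
move=> vN.
have E Z : config_state N G (set_slot m v Z) =
    Z ord0 (G v.+1) * \prod_(i < N | i != Ordinal vN) m i ord0 (G i.+1).
  rewrite /config_state (bigD1 (Ordinal vN)) //= set_slot_same; congr (_ * _).
  apply: eq_bigr => i iv; rewrite /set_slot ifF //.
  by apply: contraNF iv => /eqP iv; apply/eqP/val_inj.
by rewrite !E !mxE; ring.
Qed.

(* At each [Swap v] only the term [c = F v.+1] of the sum over paths survives. *)
Lemma walk_swaps N (F G : nat -> 'I_d) vs : all (fun v => v < N)%N vs ->
  walk (config_state N G) (map Swap vs) (F 0%N) (G 0%N) (fun v => delta_mx ord0 (F v.+1)) =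
  [forall j : 'I_N.+1, F (swaps_perm vs j) == G j]%:R.
Proof.
elim: vs F => [|v vs IH] F /=.
  move=> _; rewrite /config_state.
  have -> : [forall j : 'I_N.+1, F j == G j] =
      (F 0%N == G 0%N) && [forall j : 'I_N, F j.+1 == G j.+1].
    apply/forallP/andP => [FG|[FG0 /forallP FG] j].
      by split; [exact: (FG ord0)|apply/forallP => j; exact: (FG (lift ord0 j))].
    by case: (unliftP ord0 j) => [j' ->|->]; [exact: (FG j')|].
  rewrite -mulnb natrM; congr (_ * _).
  have [/forallP FG|/forallPn [j FGj]] := boolP [forall j : 'I_N, F j.+1 == G j.+1].
    by rewrite big1 // => j _; rewrite mxE eqxx /= eq_sym FG.
  rewrite (bigD1 j) //= mxE eqxx /= eq_sym (negPf FGj) mul0r //.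
case/andP => vN vsN.
pose F' := F \o gamma v.+1.
have F'0 : F' 0%N = F v.+1 by [].
rewrite (bigD1 (F v.+1)) //= [X in _ + X]big1 ?addr0 => [|c cv]; last first.
  rewrite mul_delta_mx_cond eq_sym (negPf cv) mulr0n.
  have := @walk_lin R d w 1 _ N (@config_state_lin N G) (map Swap vs) c (G 0%N)
    (fun v => delta_mx ord0 (F v.+1)) v (-1) 0 0 vN.
  by rewrite scaler0 addr0 mulN1r addNr.
rewrite mul_delta_mx -F'0.
rewrite (_ : set_slot _ _ _ = fun u => delta_mx ord0 (F' u.+1)) ?IH //.
apply/funext => u; rewrite /set_slot /F' /= /swap0 /= eqSS.
by case: eqP.
Qed.

(** The product state is the sum of the diagonal coefficients over all basis tensors, weighted by
    the product of the [w]. Here the colour of the point 0 is prescribed to be [a0]. *)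
Lemma walk_config_state N t a0 a b (m : nat -> 'M[R]_d) : all (letter_lt N) t ->
  \sum_(f : {ffun 'I_N.+1 -> 'I_d} | f ord0 == a0) (\prod_j w (f j)) *
    walk (config_state N (fun n => f (inord n))) t a b
         (fun v => delta_mx ord0 (f (inord v.+1)) *m m v) =
  w a0 * walk (product_state N) t a b m.
Proof.
elim: t a m => [|l t IH] a m /=.
  move=> _; under eq_bigr do rewrite mulrCA; rewrite -mulr_sumr mulrCA; congr (_ * _).
  rewrite big_mkcond /=.
  (* The point 0 carries the constraint on its colour, the point [v.+1] a diagonal entry of slot
     [v]; the sum over colourings then factors over the points. *)
  pose Fm (j : 'I_N.+1) c := w c * (if unlift ord0 j is Some v then m v c c else (c == a0)%:R).
  transitivity (\sum_(f : {ffun 'I_N.+1 -> 'I_d}) \prod_j Fm j (f j)).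
    apply: eq_bigr => f _; rewrite /Fm big_split /= [X in _ = _ * X]big_ord_recl.
    rewrite unlift_none /config_state; case: eqP => _; rewrite /= ?mul0r ?mulr0 // mul1r.
    congr (_ * _); apply: eq_bigr => v _; rewrite liftK -rowE mxE.
    have -> // : inord v.+1 = lift ord0 v :> 'I_N.+1.
    by apply/val_inj; rewrite /= inordK // ltnS.
  rewrite -bigA_distr_bigA /= big_ord_recl; congr (_ * _).
    rewrite (bigD1 a0) //= big1 ?addr0 /Fm ?unlift_none ?eqxx ?mulr1 // => c ca.
    by rewrite (negPf ca) mulr0.
  by apply: eq_bigr => v _; apply: eq_bigr => c _; rewrite /Fm liftK.
case/andP => lN tN.
have step v (Z : 'M[R]_d) c :
  \sum_(f : {ffun 'I_N.+1 -> 'I_d} | f ord0 == a0) (\prod_j w (f j)) *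
    walk (config_state N (fun n => f (inord n))) t c b
         (set_slot (fun v => delta_mx ord0 (f (inord v.+1)) *m m v) v
            (delta_mx ord0 (f (inord v.+1)) *m m v *m Z)) =
  w a0 * walk (product_state N) t c b (set_slot m v (m v *m Z)).
  rewrite -IH //; apply: eq_bigr => f _; congr (_ * walk _ _ _ _ _).
  by apply/funext => u; rewrite /set_slot; case: eqP => [->|//]; rewrite mulmxA.
case: l lN => [v| |n] /= lN.
- under eq_bigr do rewrite mulr_sumr; rewrite exchange_big /= mulr_sumr.
  by apply: eq_bigr => c _; exact: step.
- by under eq_bigr do rewrite mulrCA; rewrite -mulr_sumr IH // mulrCA.
- under eq_bigr do rewrite mulr_sumr; rewrite exchange_big /= mulr_sumr.
  apply: eq_bigr => v _.
  under eq_bigr do rewrite mulr_sumr; rewrite exchange_big /= mulr_sumr.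
  by apply: eq_bigr => c _; exact: step.
Qed.

Hypothesis w1 : \sum_i w i = 1.

(** A product of transpositions permutes the basis tensors, so a colouring contributes to the trace
    exactly when it is fixed; this is the sum in [chiE] over the point 0 and the [N] slots. *)
Lemma model_swaps (a0 : 'I_d) N vs : all (fun v => v < N)%N vs ->
  model w N (map Swap vs) = chi w (swaps_perm vs).
Proof.
move=> vsN; rewrite (chiE w1 a0 (N := N.+1)); last first.
  by move=> n Nn; apply: (swaps_perm_fix vsN).
rewrite /model; under eq_bigr do rewrite -walk_config_state ?all_map //.
rewrite [RHS]big_mkcond [RHS](partition_big (fun f : {ffun 'I_N.+1 -> 'I_d} => f ord0) predT) //=.
apply: eq_bigr => a _; apply: eq_bigr => f /eqP fa.
pose F n := f (inord n).
have Fa : F 0%N = a by rewrite -fa; congr (f _); apply/val_inj; rewrite /= inordK.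
rewrite -[X in walk _ _ X]Fa -[X in walk _ _ _ X]Fa.
rewrite [X in walk _ _ _ _ X](_ : _ = fun v => delta_mx ord0 (F v.+1)); last first.
  by apply/funext => v; rewrite mulmx1.
rewrite walk_swaps //.
have -> : [forall j : 'I_N.+1, F (swaps_perm vs j) == F j] =
   [forall j : 'I_N.+1, forall k : 'I_N.+1, (swaps_perm vs j == k) ==> (f k == f j)].
  have FE (k : 'I_N.+1) : F k = f k by rewrite /F inord_val.
  apply/forallP/forallP => FF j.
    apply/forallP => k; apply/implyP => /eqP jk.
    by rewrite -!FE -jk.
  have jN : (swaps_perm vs j < N.+1)%N by rewrite ltnS (swaps_perm_lt vsN) // -ltnS.
  by have /forallP/(_ (Ordinal jN)) := FF j; rewrite eqxx -!FE.
by case: ifP; rewrite ?mulr1 ?mulr0.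
Qed.

(** The shape of the [(a, b)] entry of a [k]-th matrix power: the words are the edge sequences of
    the paths of length [k] from [a] to [b]. *)
Fixpoint path_sum (K : comNzRingType) (F : seq ('I_d * 'I_d) -> K) k a b : K :=
  if k is k'.+1 then \sum_c path_sum (fun s => F ((a, c) :: s)) k' c b
  else (a == b)%:R * F [::].

Lemma eq_path_sum (K : comNzRingType) (F G : seq ('I_d * 'I_d) -> K) k a b :
  (forall s, size s = k -> F s = G s) -> path_sum F k a b = path_sum G k a b.
Proof.
elim: k F G a => [|k IH] F G a FG /=; first by rewrite FG.
by apply: eq_bigr => c _; apply: IH => s sk; apply: FG; rewrite /= sk.
Qed.

Lemma path_sum_sum (K : comNzRingType) (J : finType) (F : J -> seq ('I_d * 'I_d) -> K) k a b :
  path_sum (fun s => \sum_j F j s) k a b = \sum_j path_sum (F j) k a b.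
Proof.
elim: k F a => [|k IH] F a /=; first by rewrite mulr_sumr.
rewrite exchange_big /=; apply: eq_bigr => c _; exact: IH.
Qed.

(* The state of the word [s] in the sums over [n] slots of the centred units,
   multiplied on the left by the product of the [m v]. *)
Fixpoint slot_sum n (s : seq ('I_d * 'I_d)) (m : nat -> 'M[R]_d) : R :=
  if s is x :: s' then \sum_(v < n) slot_sum n s' (set_slot m v (m v *m centred_unit w x))
  else product_state n m.

Lemma walk_nseq n k a b m :
  walk (product_state n) (nseq k (Fluct n)) a b m = path_sum (fun s => slot_sum n s m) k a b.
Proof.
elim: k a m => [//|k IH] a m /=.
rewrite exchange_big /=; apply: eq_bigr => c _.
by rewrite path_sum_sum; apply: eq_bigr => v _.
Qed.

Lemma slot_sum_ext n s (m m' : nat -> 'M[R]_d) : (forall v, (v < n)%N -> m v = m' v) ->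
  slot_sum n s m = slot_sum n s m'.
Proof.
elim: s m m' => [|x s IH] m m' mm' /=; first by apply: eq_bigr => v _; rewrite mm'.
apply: eq_bigr => v _; apply: IH => u un; rewrite /set_slot mm' //.
by case: eqP => // _; rewrite mm'.
Qed.

(** Each letter goes either to slot [n] or to an earlier slot, and matrices at different slots do
    not interact; this is the recursion defining [conv]. *)
Lemma slot_sumS n s m : slot_sum n.+1 s m =
  split_sum (fun s1 s2 =>
    slot_state (m n *m foldr (fun x X => centred_unit w x *m X) 1%:M s1) * slot_sum n s2 m) s.
Proof.
elim: s m => [|x s IH] m /=.
  by rewrite /product_state big_ord_recr /= mulmx1 mulrC.
rewrite big_ord_recr /= addrC; congr (_ + _).
  rewrite IH; apply: eq_split_sum => a b _; rewrite set_slot_same mulmxA; congr (_ * _).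
  by apply: slot_sum_ext => v vn; rewrite /set_slot ltn_eqF.
transitivity (\sum_(v < n) split_sum (fun s1 s2 =>
    slot_state (m n *m foldr (fun x X => centred_unit w x *m X) 1%:M s1) *
    slot_sum n s2 (set_slot m v (m v *m centred_unit w x))) s).
  apply: eq_bigr => v _; rewrite IH; apply: eq_split_sum => a b _.
  by rewrite {1}/set_slot gtn_eqF.
rewrite -split_sum_big; apply: eq_split_sum => a b _.
by rewrite /= mulr_sumr.
Qed.

Lemma slot_sum_conv n s : slot_sum n s (fun=> 1%:M) = conv (unit_moment w) n s.
Proof.
elim: n s => [|n IH] s; last first.
  by rewrite slot_sumS; apply: eq_split_sum => a b _; rewrite mul1mx IH.
by case: s => [|x s] /=; rewrite ?big_ord0 // /product_state big_ord0.
Qed.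

Lemma model_fluct_power n k :
  model w n (nseq k (Fluct n)) =
  \sum_a w a * path_sum (conv (unit_moment w) n) k a a.
Proof.
apply: eq_bigr => a _; rewrite walk_nseq; congr (_ * _).
by apply: eq_path_sum => s _; exact: slot_sum_conv.
Qed.

End SlotModelValues.

(** * The GNS representation *)

Section CauchySchwarz.
Context {R : realType} {H : completeNormedModType R[i]}.
Variable ip : {dot H for (@Num.conj R[i])}.
Hypothesis ip_norm : forall x : H, ip x x = `|x| ^+ 2.

Lemma ip_le (x y : H) : `|ip x y| <= `|x| * `|y|.
Proof.
have [->|y0] := eqVneq y 0; first by rewrite linear0r !normr0 mulr0.
have n0 : 0 < `|y| ^+ 2 by rewrite exprn_gt0 // normr_gt0.
rewrite -(@ler_pXn2r _ 2) ?nnegrE ?mulr_ge0 // exprMn -ler_pdivrMr //.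
(* The coefficient of the orthogonal projection of [x] to the line of [y]; the squared norm of the
   remainder is nonnegative. *)
pose c := ip x y / `|y| ^+ 2.
have cc : Num.conj c = Num.conj (ip x y) / `|y| ^+ 2.
  by rewrite rmorphM fmorphV /= [X in _ / X]geC0_conj // ltW.
have : 0 <= ip (x - c *: y) (x - c *: y) by rewrite ip_norm exprn_ge0.
have E1 : ip (c *: y) x = c * Num.conj (ip x y).
  by rewrite linearZl_LR /= (hermC ip y x) expr0 mul1r.
have E2 u : ip u (c *: y) = Num.conj c * ip u y by rewrite linearZr_LR.
have E3 : ip (c *: y) (c *: y) = c * (Num.conj c * `|y| ^+ 2).
  by rewrite linearZl_LR /= E2 ip_norm.
have -> : ip (x - c *: y) (x - c *: y) =
    ip x x - ip x (c *: y) - (ip (c *: y) x - ip (c *: y) (c *: y)).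
  by rewrite linearBl !linearBr.
rewrite E1 E2 E3 ip_norm cc /c normCK.
rewrite (_ : _ - _ = `|x| ^+ 2 - ip x y * Num.conj (ip x y) / `|y| ^+ 2) ?subr_ge0 //.
by field; rewrite normr_eq0.
Qed.

End CauchySchwarz.

Lemma norm_realP (R : realType) (V : normedZmodType R[i]) (x : V) :
  exists2 r : R, 0 <= r & `|x| = r%:C.
Proof.
exists (complex.Re `|x|); have : 0 <= `|x| by []; case: (`|x|) => a b.
  by rewrite lecE /= => /andP[].
by rewrite lecE /= => /andP[/eqP -> _].
Qed.

Section Gns.
Context {R : realType} {H : completeNormedModType R[i]}.
Context {ip : {dot H for (@Num.conj R[i])}}.
Context {hat : Sinf -> H} {U : Sinf -> {linear H -> H}} {d : nat} {w : 'I_d -> R}.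
Context {A0 : {linear H -> H}}.
Hypothesis gnsP : is_gns ip hat U w.
Hypothesis meanP : is_sot_mean ip U A0.

(** The inner products of the means converge to that of [A0 x], and averages of an eventually
    constant sequence converge to the constant. *)
Lemma ip_mean (x y : H) (L : R[i]) N :
  (forall j, (N < j)%N -> ip (U (gamma j) x) y = L) -> ip (A0 x) y = L.
Proof.
move=> tL; have [ip_norm _ _ _ _] := gnsP; have [_ /(_ x) /cvgrPdist_lt cvgA] := meanP.
pose t j := ip (U (gamma j) x) y.
(* The total deviation of the first [N] terms; the average of [m] terms then differs from [L] by
   exactly [K / m]. *)
pose K := \sum_(1 <= j < N.+1) (t j - L).
pose avg m : H := (m%:R : R[i])^-1 *: \sum_(1 <= i < m.+1) U (gamma i) x.
have avgE m : (N <= m)%N -> (0 < m)%N -> ip (avg m) y - L = K / m%:R.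
  move=> Nm m0; have m0' : (m%:R : R[i]) != 0 by rewrite pnatr_eq0 -lt0n.
  rewrite linearZl_LR linear_sumlz /=.
  have -> : \sum_(1 <= i < m.+1) ip (U (gamma i) x) y = K + m%:R * L.
    rewrite -[RHS]addr0 /K (@big_cat_nat _ _ _ N.+1) //=.
    rewrite [X in _ + X](_ : _ = (m - N)%:R * L).
      rewrite sumrB sumr_const_nat subSS subn0 natrB // -mulr_natl; ring.
    rewrite big_nat_cond (eq_bigr (fun=> L)) -?big_nat_cond.
      by rewrite sumr_const_nat subSS mulr_natl.
    by move=> j /andP[/andP[Nj _] _]; exact: tL.
  by field.
have [k k0 Kk] := norm_realP K; have [r r0 yr] := norm_realP y.
have [z z0 Dz] := norm_realP (ip (A0 x) y - L).
apply/eqP; rewrite -subr_eq0 -normr_eq0 Dz; apply/eqP; congr (_%:C).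
apply/eqP; rewrite eq_le z0 andbT; apply/ler_addgt0Pl => e e0; rewrite addr0.
(* One half of [e] pays for the distance of [A0 x] from the mean, multiplied by the norm [r] of [y];
   the other half pays for [K / m]. Taking [r + 1] avoids division by zero. *)
pose e1 := e / 2 / (r + 1).
have e10 : 0 < e1 by rewrite !divr_gt0 // ltr_wpDl.
have near1 : \forall m \near \oo, `|A0 x - avg m| < e1%:C by apply: cvgA; rewrite ltcR.
have [m [[Am km] [Nm m0]]] := filter_ex (filterI (filterI near1
  (nbhs_infty_gtr (k / (e / 2)))) (filterI (nbhs_infty_ge N) (nbhs_infty_gt 0))).
rewrite -lecR -Dz (_ : ip (A0 x) y - L = ip (A0 x - avg m) y + (ip (avg m) y - L)); last first.
  by rewrite linearBl; ring.
apply: le_trans (ler_normD _ _) _.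
rewrite (_ : e = e1 * (r + 1) + e / 2); last first.
  by rewrite /e1 divfK ?gt_eqF ?ltr_wpDl //; field.
rewrite rmorphD; apply: lerD.
  apply: le_trans (ip_le ip_norm _ _) _; rewrite yr.
  rewrite rmorphM; apply: ler_pM => //; [by rewrite -yr|exact: ltW|by rewrite lecR lerDl].
rewrite avgE // normrM normfV Kk normr_nat.
have -> : (m%:R : R[i]) = (m%:R : R)%:C by rewrite rmorph_nat.
rewrite -fmorphV -rmorphM lecR ler_pdivrMr ?ltr0n // mulrC -ler_pdivrMr ?divr_gt0 //.
exact: ltW.
Qed.

Hypothesis w1 : \sum_i w i = 1.

Fixpoint act (t : seq letter) (x : H) : H :=
  match t with
  | [::] => x
  | Swap v :: t' => U (gamma v.+1) (act t' x)
  | Mean :: t' => A0 (act t' x)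
  | Fluct n :: t' => \sum_(1 <= v < n.+1) (U (gamma v) (act t' x) - A0 (act t' x))
  end.

Lemma act_swaps vs t x : act (map Swap vs ++ t) x = U (swaps_perm vs) (act t x).
Proof.
have [_ _ _ [U1 UM _] _] := gnsP.
by elim: vs => [|v vs IH] /=; rewrite ?U1 // UM IH.
Qed.

Lemma act_fluct u n t x : act (u ++ Fluct n :: t) x =
  \sum_(v < n) (act (u ++ Swap v :: t) x - act (u ++ Mean :: t) x).
Proof.
elim: u => [|l u IH] /=; first by rewrite big_add1 /= big_mkord.
case: l => [v| |m] /=; rewrite IH.
- by rewrite raddf_sum; apply: eq_bigr => v' _; rewrite raddfB.
- by rewrite raddf_sum; apply: eq_bigr => v' _; rewrite raddfB.
- under eq_bigr do rewrite (raddf_sum (U _)) (raddf_sum A0) -sumrB; rewrite exchange_big /=.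
  apply: eq_bigr => v' _; rewrite -sumrB; apply: eq_bigr => v _.
  by rewrite (raddfB (U _)) (raddfB A0) !opprB addrACA [RHS]addrACA; congr (_ + _); exact: addrC.
Qed.

(** Induction on what follows the leading swaps. At a [Mean] the swaps are moved to the other side
    by unitarity, and [ip_mean] replaces [A0] by transpositions with points that the word does not
    move. Their values are known by induction, and [model_fresh] shows them to be constant and equal
    to the claimed value. *)
Lemma gns_word_mean (a0 : 'I_d) N vs t :
  all (letter_lt N) (map Swap vs ++ t) -> ~~ has is_fluct t ->
  ip (act (map Swap vs ++ t) (hat 1%g)) (hat 1%g) = (model w N (map Swap vs ++ t))%:C.
Proof.
have [_ _ hatE [U1 UM Uip] Uhat] := gnsP.
elim: t N vs => [|[v| |//] t IH] N vs.
- rewrite cats0 all_map => vsN _; rewrite (model_swaps w1 a0) //.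
  by rewrite -[map _ _]cats0 act_swaps /= Uhat hatE mulg1 invg1 mulg1.
- by move=> tN tF; rewrite -cat_rcons -map_rcons; apply: IH; rewrite // map_rcons cat_rcons.
rewrite all_cat /= => /andP[vsN tN] tF.
have hat1 : hat 1%g = U (swaps_perm vs) (U (swaps_perm vs)^-1%g (hat 1%g)).
  by rewrite -UM mulgV U1.
rewrite act_swaps /= [X in ip _ X]hat1 Uip.
apply: (@ip_mean _ _ _ N) => j Nj.
rewrite -(Uip (swaps_perm vs)) -hat1.
(* The transposition [gamma j.+1] is the letter [Swap j], and its slot [j] lies beyond all letters
   of the word. *)
case: j Nj => [//|j] Nj.
rewrite -[U (gamma j.+1) _]/(act (Swap j :: t) _) -act_swaps -cat_rcons -map_rcons.
have Nj1 : (N <= j.+1)%N by rewrite ltnW.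
have lt_widen s : all (letter_lt N) s -> all (letter_lt j.+1) s.
  apply: sub_all => -[v| |n] //= vN; first exact: leq_trans vN Nj1.
  exact: leq_trans vN Nj1.
rewrite (IH j.+1) //; last first.
  by rewrite map_rcons cat_rcons all_cat /= ltnSn !lt_widen.
by rewrite map_rcons cat_rcons (model_fresh w1 (N := N)).
Qed.

(** The fluctuation letters are expanded from left to right into differences of [Swap] and [Mean],
    in the same way on both sides; [u] is the part already expanded. *)
Lemma gns_word (a0 : 'I_d) N t : all (letter_lt N) t ->
  ip (act t (hat 1%g)) (hat 1%g) = (model w N t)%:C.
Proof.
suff main u : ~~ has is_fluct u -> all (letter_lt N) (u ++ t) ->
    ip (act (u ++ t) (hat 1%g)) (hat 1%g) = (model w N (u ++ t))%:C.
  exact: (main [::]).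
elim: t u => [|l t IH] u uF; first by rewrite cats0 => uN; exact: (gns_word_mean a0 (vs := [::])).

case: (boolP (is_fluct l)) => [|lF]; last first.
  by rewrite -cat_rcons; apply: IH; rewrite has_rcons negb_or lF.
case: l => // n _; rewrite all_cat /= => /andP[uN /andP[nN tN]].
have ip_sum (F : 'I_n -> H) z : ip (\sum_v F v) z = \sum_v ip (F v) z by exact: linear_sumlz.
rewrite act_fluct model_fluct // ip_sum rmorph_sum; apply: eq_bigr => v _.
have vN := leq_trans (ltn_ord v) nN.
have ipBl x y z : ip (x - y) z = ip x z - ip y z by exact: linearBl.
rewrite ipBl rmorphB -!cat_rcons !IH ?has_rcons ?negb_or //.
  by rewrite cat_rcons all_cat uN /= tN.
by rewrite cat_rcons all_cat uN /= vN.
Qed.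

Lemma tr_fluctuation (a0 : 'I_d) n k :
  tr ip hat (iter k (fluctuation U A0 n)) =
  ((Num.sqrt n%:R)^-1 ^+ k *
   \sum_a w a * path_sum (conv (unit_moment w) n) k a a)%:C.
Proof.
have -> : tr ip hat (iter k (fluctuation U A0 n)) =
    ip (((Num.sqrt n%:R)^-1 ^+ k)%:C *: act (nseq k (Fluct n)) (hat 1%g)) (hat 1%g).
  rewrite /tr; congr (ip _ _); elim: k => [|k IH] /=; first by rewrite scale1r.
  rewrite IH /fluctuation exprS rmorphM -scalerA; congr (_ *: _).
  rewrite scaler_sumr; apply: eq_bigr => i _.
  by rewrite scalerBr; congr (_ - _); exact: linearZ_LR.
rewrite linearZl_LR /= (gns_word a0 (N := n)); last first.
  by rewrite all_nseq /= leqnn orbT.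
by rewrite (model_fluct_power) // -rmorphM.
Qed.

End Gns.

(** * Moments and weak convergence *)

Section Moments.
Context {R : realType}.
Implicit Types (t M : R) (k : nat) (P : probability (measurableTypeR R) R).

(* [t] truncated to [- M, M] *)
Definition clip M t : R := (`|t + M| - `|t - M|) / 2.

Lemma clip_id M t : `|t| <= M -> clip M t = t.
Proof.
rewrite ler_norml => /andP[tM Mt]; rewrite /clip ger0_norm; last by rewrite -lerBlDr sub0r.
by rewrite ler0_norm ?subr_le0 //; field.
Qed.

Lemma clip_gt M t : 0 <= M -> M < t -> clip M t = M.
Proof.
move=> M0 Mt; have t0 := le_lt_trans M0 Mt; rewrite /clip.
have -> : `|t + M| = t + M by rewrite ger0_norm // addr_ge0 // ltW.
have -> : `|t - M| = t - M by rewrite ger0_norm // subr_ge0 ltW.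
by field.
Qed.

Lemma clipN M t : clip M (- t) = - clip M t.
Proof.
rewrite /clip; have -> : `|- t + M| = `|t - M| by rewrite -normrN opprD opprK.
have -> : `|- t - M| = `|t + M| by rewrite -normrN opprD !opprK.
by field.
Qed.

Lemma norm_clip_le M t : 0 <= M -> `|clip M t| <= M.
Proof.
move=> M0; have [tM|] := leP `|t| M; first by rewrite clip_id.
have [t0|t0] := ler0P t => Mt.
  by rewrite -[t]opprK clipN normrN clip_gt ?ger0_norm.
by rewrite clip_gt ?ger0_norm.
Qed.

(** The difference vanishes where the absolute value of [t] is at most [M]. Beyond that it is at
    most the [k]-th power of this absolute value, which itself dominates [M ^+ k]. *)
Lemma clip_exprn k M t : 0 < M ->
  `|t ^+ k - clip M t ^+ k| <= t ^+ (2 * k) / M ^+ k.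
Proof.
move=> M0; rewrite exprM.
have pos u : M < u -> `|u ^+ k - clip M u ^+ k| <= (u ^+ 2) ^+ k / M ^+ k.
  move=> Mu; have u0 := lt_trans M0 Mu; rewrite clip_gt ?(ltW M0) //.
  have MuX : M ^+ k <= u ^+ k by apply: lerXn2r; rewrite ?nnegrE ltW.
  rewrite ger0_norm ?subr_ge0 // ler_pdivlMr ?exprn_gt0 //.
  rewrite -exprM mulnC exprM expr2; apply: ler_pM => //; first by rewrite subr_ge0.
    by rewrite exprn_ge0 // ltW.
  by rewrite lerBlDr lerDl exprn_ge0 // ltW.
have [tM|] := leP `|t| M.
  rewrite clip_id // subrr normr0; apply: divr_ge0; apply: exprn_ge0.
    exact: sqr_ge0.
  exact: ltW.
have [t0|t0] := ler0P t => Mt; last exact: pos.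
rewrite -[t]opprK clipN sqrrN (exprNn (- t)) (exprNn (clip _ _)) -mulrBr.
by rewrite normrM normrX normrN1 expr1n mul1r; exact: pos.
Qed.

Lemma clip_continuous M : continuous (clip M).
Proof.
move=> t; apply: cvgM; last exact: cvg_cst.
by apply: cvgB; apply: cvg_norm; [apply: cvgD|apply: cvgB]; (exact: cvg_id || exact: cvg_cst).
Qed.

Lemma clip_exprn_continuous M k : continuous (fun t => clip M t ^+ k).
Proof.
move=> t; apply: (@continuous_comp _ _ _ (clip M) (fun x => x ^+ k)).
  exact: clip_continuous.
exact: exprn_continuous.
Qed.

Lemma clip_exprn_bounded M k : 0 <= M -> bounded_fun (fun t => clip M t ^+ k).
Proof.
move=> M0; exists (M ^+ k); split; first exact: num_real.
move=> x Mx t _ /=; rewrite normrX (le_trans _ (ltW Mx)) //.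
by rewrite lerXn2r ?nnegrE // norm_clip_le.
Qed.

Lemma integrable_clip P M k : 0 <= M ->
  P.-integrable setT (EFin \o (fun t => clip M t ^+ k)).
Proof.
move=> M0; apply: measurable_bounded_integrable => //.
- by apply: le_lt_trans (probability_le1 P _) (ltry 1).
- by apply: continuous_measurable_fun; exact: clip_exprn_continuous.
- exact: clip_exprn_bounded.
Qed.

Lemma integrable_exprn_compact P K k : P `[- K, K]%classic = 1%E ->
  P.-integrable setT (EFin \o (fun t => t ^+ k)).
Proof.
move=> PK; have mK : measurable (`[- K, K]%classic : set R) by [].
have PN : P (~` `[- K, K]%classic) = 0%E by rewrite probability_setC // PK subee.
have PI := @negligible_integrable _ _ _ P setT _
  (EFin \o (fun t => t ^+ k)) (measurableC mK) measurableT _ PN.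
refine (proj2 (PI _) _).
  by apply/measurable_EFinP; exact: exprn_measurable.
rewrite setTD setCK; apply: measurable_bounded_integrable => //.
- by apply: le_lt_trans (probability_le1 P _) (ltry 1).
exists (`|K| ^+ k); split; first exact: num_real.
move=> x Kx t /=; rewrite in_itv /= => /andP[Kt tK].
rewrite normrX (le_trans _ (ltW Kx)) // lerXn2r ?nnegrE //.
by rewrite (le_trans _ (ler_norm K)) // ler_norml Kt.
Qed.

Lemma integrable_exprn P k : P.-integrable setT (EFin \o (fun t => t ^+ (2 * k))) ->
  P.-integrable setT (EFin \o (fun t => t ^+ k)).
Proof.
move=> i2; have i1 : P.-integrable setT (EFin \o (fun t : R => 1 + t ^+ (2 * k))).
  rewrite (_ : EFin \o _ = (EFin \o cst 1) \+ (EFin \o (fun t : R => t ^+ (2 * k)))) //.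
  by apply: integrableD => //; exact: finite_measure_integrable_cst.
apply: le_integrable i1 => //.
  by apply/measurable_EFinP; exact: exprn_measurable.
move=> t _ /=; rewrite lee_fin [leRHS]ger0_norm; last first.
  by rewrite addr_ge0 // exprM exprn_ge0 // sqr_ge0.
have -> : t ^+ (2 * k) = `|t ^+ k| ^+ 2.
  by rewrite real_normK ?num_real // -exprM mulnC.
have := sqr_ge0 (`|t ^+ k| - 1); have := normr_ge0 (t ^+ k); nra.
Qed.

Lemma integral_clip P k M : 0 < M ->
  P.-integrable setT (EFin \o (fun t => t ^+ (2 * k))) ->
  `|\int[P]_t (t ^+ k) - \int[P]_t (clip M t ^+ k)| <=
  (\int[P]_t (t ^+ (2 * k))) / M ^+ k.
Proof.
move=> M0 i2; have i1 := integrable_exprn i2; have ic := integrable_clip P k (ltW M0).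
have iB : P.-integrable setT (EFin \o (fun t => t ^+ k - clip M t ^+ k)).
  exact: (integrableB measurableT i1 ic).
rewrite -RintegralB // -RintegralZr //.
apply: le_trans (le_normr_Rintegral _ _) _ => //.
apply: le_Rintegral => //.
- exact: integrable_norm.
- exact: (integrableZr measurableT (M ^+ k)^-1 i2).
- by move=> t _; exact: clip_exprn.
Qed.

Variables (mun : nat -> probability (measurableTypeR R) R).
Variables (mu : probability (measurableTypeR R) R) (L : nat -> R).
Hypothesis mun_compact : forall n, (0 < n)%N -> exists K : R, mun n `[- K, K]%classic = 1%E.
Hypothesis mun_L : forall k, (fun n => \int[mun n]_t (t ^+ k)) @ \oo --> L k.
Hypothesis mun_mu : cvg_weakly mun mu.

Let mun_int k n : (0 < n)%N -> (mun n).-integrable setT (EFin \o (fun t => t ^+ k)).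
Proof. by move=> /mun_compact[K]; exact: integrable_exprn_compact. Qed.

(** Clipped powers are bounded and continuous, so weak convergence applies to them, and for even
    exponents they lie below the powers whose integrals tend to [L]. *)
Lemma limit_clip_le k M : 0 <= M -> \int[mu]_t (clip M t ^+ (2 * k)) <= L (2 * k).
Proof.
move=> M0.
have cm := mun_mu (@clip_exprn_continuous M (2 * k)) (clip_exprn_bounded (2 * k) M0).
apply: (ler_cvg_to cm (@mun_L (2 * k)%N)).
near=> n; have n0 : (0 < n)%N by near: n; exact: nbhs_infty_gt.
apply: le_Rintegral => //; [exact: integrable_clip|exact: mun_int|].
move=> t _; rewrite !exprM -[clip M t ^+ 2]real_normK ?num_real //.
rewrite -[t ^+ 2]real_normK ?num_real // lerXn2r ?nnegrE ?exprn_ge0 //.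
rewrite lerXn2r ?nnegrE //.
have [tM|/ltW] := leP `|t| M; first by rewrite clip_id.
exact/le_trans/norm_clip_le.
Unshelve. all: by end_near. Qed.

(** Fatou's lemma for clipping levels tending to infinity, with the uniform bound of
    [limit_clip_le]. *)
Lemma limit_integrable k : mu.-integrable setT (EFin \o (fun t => t ^+ (2 * k))).
Proof.
pose g n t := (clip n%:R t ^+ (2 * k))%:E.
have mg n : measurable_fun setT (g n).
  apply/measurable_EFinP; apply: continuous_measurable_fun.
  exact: clip_exprn_continuous.
have g0 n t : (0 <= g n t)%E.
  by rewrite /g lee_fin exprM; apply: exprn_ge0; exact: sqr_ge0.
apply/integrableP; split.
  by apply/measurable_EFinP; exact: exprn_measurable.
have gE t : limn_einf (g ^~ t) = (`|t ^+ (2 * k)|)%:E.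
  have -> : `|t ^+ (2 * k)| = t ^+ (2 * k).
    by apply: ger0_norm; rewrite exprM; apply: exprn_ge0; exact: sqr_ge0.
  have gt : g ^~ t @ \oo --> (t ^+ (2 * k))%:E.
    apply: cvg_near_cst; near=> n; rewrite /g clip_id //.
    by near: n; exact: nbhs_infty_ger.
  by rewrite is_cvg_limn_einfE ?(cvg_lim _ gt) //; apply/cvg_ex; eexists; exact: gt.
apply: le_lt_trans (_ : (L (2 * k))%:E < +oo)%E; last exact: ltry.
under eq_integral do rewrite /= -gE.
apply: le_trans (fatou _ _ _ _) _ => //.
rewrite limn_einf_lim; apply: lime_le; first exact: is_cvg_einfs.
apply: nearW => n; apply: (@le_trans _ _ (\int[mu]_t g n t)%E).
  by apply: ereal_inf_lbound; exists n => /=.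
rewrite -[leLHS]fineK; last first.
  by apply: integrable_fin_num => //; apply: integrable_clip.
by rewrite lee_fin; exact: limit_clip_le.
Unshelve. all: by end_near. Qed.

(** Weak convergence only controls clipped powers. The clipping error is bounded through the moments
    of order [2 * k], uniformly along the sequence and for the limit, and is small for a large level
    [M]. *)
Lemma limit_moment k : (0 < k)%N ->
  mu.-integrable setT (EFin \o (fun t => t ^+ k)) /\ \int[mu]_t (t ^+ k) = L k.
Proof.
move=> k0; have i2 := limit_integrable k; split; first exact: integrable_exprn.
pose a := \int[mu]_t (t ^+ (2 * k)); pose b := L (2 * k).
have a0 : 0 <= a by apply: Rintegral_ge0 => t _; rewrite exprM exprn_ge0 // sqr_ge0.
have b0 : 0 <= b.
  apply: (cvgr_to_ge (@mun_L (2 * k)%N)); apply: nearW => n.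
  by apply: Rintegral_ge0 => t _; rewrite exprM exprn_ge0 // sqr_ge0.
apply/eqP; rewrite -subr_eq0 -normr_eq0 eq_le normr_ge0 andbT.
apply/ler_addgt0Pl => e e0; rewrite addr0.
have e4 : 0 < e / 4 by rewrite divr_gt0.
(* Since [1 <= M] and [0 < k], the power [M ^+ k] is at least [M], which makes both clipping errors
   at most [e / 4]. The other two quarters are the weak convergence and the convergence to [L k]. *)
pose M := 1 + (a + b + 1) / (e / 4).
have M1 : 1 <= M by rewrite lerDl divr_ge0 ?(ltW e4) // !addr_ge0.
have M0 : 0 < M by exact: lt_le_trans M1.
have small u : u <= a + b + 1 -> u / M ^+ k <= e / 4.
  move=> uab; rewrite ler_pdivrMr ?exprn_gt0 //.
  apply: (@le_trans _ _ (e / 4 * M)); last by rewrite ler_pM2l // ler_eXnr.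
  rewrite mulrDr mulrCA divff ?gt_eqF // !mulr1.
  by rewrite (le_trans uab) // lerDr ltW.
have cc := mun_mu (@clip_exprn_continuous M k) (clip_exprn_bounded k (ltW M0)).
have near1 : \forall n \near \oo, `|L k - \int[mun n]_t (t ^+ k)| < e / 4.
  by have /cvgrPdist_lt := @mun_L k; apply.
have near2 : \forall n \near \oo,
    `|\int[mu]_t (clip M t ^+ k) - \int[mun n]_t (clip M t ^+ k)| < e / 4.
  by have /cvgrPdist_lt := cc; apply.
have near3 : \forall n \near \oo, \int[mun n]_t (t ^+ (2 * k)) < b + 1.
  by apply: (cvgr_lt _ (@mun_L (2 * k)%N)); rewrite ltrDl.
have [n [[n1 n2] [n3 n0]]] := filter_ex (filterI (filterI near1 near2)
  (filterI near3 (nbhs_infty_gt 0))).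
have h1 := integral_clip M0 i2; have h2 := integral_clip M0 (mun_int (2 * k)%N n0).
have h3 : \int[mu]_t (t ^+ (2 * k)) / M ^+ k <= e / 4 by apply: small; rewrite -/a; lra.
have h4 : \int[mun n]_t (t ^+ (2 * k)) / M ^+ k <= e / 4 by apply: small; lra.
move: n1 n2 (le_trans h1 h3) (le_trans h2 h4).
move: (\int[mu]_t (t ^+ k)) (\int[mun n]_t (t ^+ k)) (\int[mu]_t (clip M t ^+ k))
  (\int[mun n]_t (clip M t ^+ k)) => x1 x2 x3 x4.
by rewrite !ltr_norml !ler_norml; lra.
Qed.

End Moments.

(** * The law of a traceless CCR-GUE matrix *)

Section UnitMoments.
Context {R : realType} {d : nat} {w : 'I_d -> R}.
Hypothesis w1 : \sum_i w i = 1.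

Lemma slot_stateD (X Y : 'M[R]_d) : slot_state w (X + Y) = slot_state w X + slot_state w Y.
Proof. by rewrite -big_split; apply: eq_bigr => b _; rewrite mxE mulrDr. Qed.

Lemma slot_stateZ k (X : 'M[R]_d) : slot_state w (k *: X) = k * slot_state w X.
Proof. by rewrite mulr_sumr; apply: eq_bigr => b _; rewrite mxE mulrCA. Qed.

Lemma unit_moment0 : unit_moment w [::] = 1.
Proof. exact: slot_state1. Qed.

Lemma unit_moment1 x : unit_moment w [:: x] = 0.
Proof.
rewrite /unit_moment /= mulmx1 /centred_unit -scalemx1 -scaleNr slot_stateD slot_stateZ.
by rewrite slot_state_unit slot_state1 // mulr1 subrr.
Qed.

(** Centring the first factor has no effect because the second has mean zero. What remains is the
    product of two matrix units minus the product of their means. *)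
Lemma unit_moment2 x y : unit_moment w [:: x; y] = entry_cov w x y.
Proof.
rewrite /unit_moment /= mulmx1 {1}/centred_unit mulmxBl mul_scalar_mx -scaleNr.
rewrite slot_stateD slot_stateZ -{2}[centred_unit w y]mulmx1.
rewrite [X in _ + _ * X](unit_moment1 y) mulr0 addr0.
rewrite /centred_unit mulmxBr mul_mx_scalar -scaleNr slot_stateD slot_stateZ.
rewrite mul_delta_mx_cond -scaler_nat slot_stateZ !slot_state_unit /entry_cov.
rewrite [y.1 == x.2]eq_sym -mulnb natrM -mulnb natrM.
by case: (eqVneq x.2 y.1) => [->|_] /=; ring.
Qed.

Lemma path_sum_cvg (F : nat -> seq ('I_d * 'I_d) -> R) (G : seq ('I_d * 'I_d) -> R) k a b :
  (forall s, size s = k -> (fun n => F n s) @ \oo --> G s) ->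
  (fun n => path_sum (F n) k a b) @ \oo --> path_sum G k a b.
Proof.
elim: k F G a => [|k IH] F G a FG /=.
  by apply: cvgM; [exact: cvg_cst|exact: FG].
apply: cvg_big => [|c _]; first exact: add_continuous.
by apply: (IH (fun n s => F n ((a, c) :: s))) => s sk; apply: FG; rewrite /= sk.
Qed.

Lemma path_sumZ (K : comNzRingType) (r : K) (F : seq ('I_d * 'I_d) -> K) k a b :
  path_sum (fun s => r * F s) k a b = r * path_sum F k a b.
Proof.
elim: k F a => [|k IH] F a /=; first by rewrite mulrCA.
by rewrite mulr_sumr; apply: eq_bigr => c _; rewrite IH.
Qed.

Lemma path_sum_real (F : seq ('I_d * 'I_d) -> R) k a b :
  path_sum (fun s => (F s)%:C) k a b = (path_sum F k a b)%:C.
Proof.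
elim: k F a => [|k IH] F a /=; first by rewrite rmorphM /= rmorph_nat.
by rewrite rmorph_sum; apply: eq_bigr => c _; rewrite IH.
Qed.

(** The factor [X] collects the entries already read, so that the induction passes through the
    noncommutative product. *)
Lemma phi_mx_power (A : algType R[i]) (phi : {scalar A}) (M : 'M[A]_d) k a b X :
  phi (X * (M ^+ k) a b) = path_sum (fun s => phi (X * \prod_(x <- s) M x.1 x.2)) k a b.
Proof.
elim: k a X => [|k IH] a X /=.
  rewrite expr0 big_nil mulr1 mxE; case: (a == b); first by rewrite mulr1 mul1r.
  by rewrite mulr0 mul0r linear0.
rewrite exprS mxE mulr_sumr linear_sum; apply: eq_bigr => c _.
rewrite mulrA IH; apply: eq_path_sum => s _.
by rewrite big_cons mulrA.
Qed.

End UnitMoments.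

Theorem theorem2p9 (R : realType) (d : nat) (w : 'I_d -> R)
    (hd : (2 <= d)%N) (hw : is_weights w)
    (mu_w : probability (measurableTypeR R) R) (hmu : is_mu w mu_w)
    (A : algType R[i]) (star : A -> A) (phi : {scalar A})
    (hphi : is_star_prob_space star phi)
    (M : 'M[A]_d) (hM : traceless_ccr_gue star phi w M)
    (k : nat) (hk : (0 < k)%N) :
  mu_w.-integrable setT (fun t : R => (t ^+ k)%:E) /\
  phi_w phi w (M ^+ k) = (\int[mu_w]_t (t ^+ k))%:C.
Proof.
have [_ _ w1] := hw; pose a0 : 'I_d := Ordinal (ltnW hd).
have [H [ip [hat [U [A0 [mun [gnsP meanP lawP mun_mu]]]]]]] := hmu.
(* The common value of both sides: the central limit theorem gives it as the limit of the moments of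
   [mun n], and [phi_word] as the moment of [M]. *)
pose L m := \sum_a w a * path_sum (wick (entry_cov w)) m a a.
have mun_L m : (fun n => \int[mun n]_t (t ^+ m)) @ \oo --> L m.
  pose F n s := (Num.sqrt n%:R)^-1 ^+ size s * conv (unit_moment w) n s.
  have : (fun n => \sum_a w a * path_sum (F n) m a a) @ \oo --> L m.
    apply: cvg_big => [|a _]; first exact: add_continuous.
    apply: cvgM; first exact: cvg_cst.
    apply: path_sum_cvg => s _.
    rewrite (_ : entry_cov w = fun x y => unit_moment w [:: x; y]).
      exact: (conv_cvg (unit_moment0 w1) (unit_moment1 w1)).
    by apply/funext => x; apply/funext => y; rewrite unit_moment2.
  (* The laws are prescribed only for positive [n], so the two sequences are compared eventually. *)
  apply: cvg_trans; apply: near_eq_cvg; near=> n.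
  have n0 : (0 < n)%N by near: n; exact: nbhs_infty_gt.
  have [_ /(_ m)] := lawP n n0.
  rewrite (tr_fluctuation gnsP meanP w1 a0) => -[->].
  rewrite mulr_sumr; apply: eq_bigr => a _; rewrite mulrCA; congr (_ * _).
  by rewrite -path_sumZ; apply: eq_path_sum => s sm; rewrite /F sm.
have mun_compact n : (0 < n)%N -> exists K : R, mun n `[- K, K]%classic = 1%E.
  by move=> /lawP[].
have [int_k ->] := limit_moment mun_compact mun_L mun_mu hk; split=> //.
rewrite /phi_w /L rmorph_sum; apply: eq_bigr => a _; rewrite rmorphM /=; congr (_ * _).
rewrite -path_sum_real -[_ a a]mul1r phi_mx_power; apply: eq_path_sum => s _.
by rewrite mul1r (phi_word hphi hM).
Unshelve. all: by end_near. Qed.
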